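(* Let $T\in\mathfrak{R}(L^2)$ be an integral operator with a kernel $\boldsymbol{T}_0$ that is a $K^\infty$ kernel of Mercer type. Then at each regular value $\lambda\in\Pi(T)$: (a) the Fredholm resolvent $T_\lambda$ of $T$ is also an integral operator, and its kernel $\boldsymbol{T}_\lambda$ (the resolvent kernel for $\boldsymbol{T}_0$ at $\lambda$) is also a $K^\infty$ kernel of Mercer type; and moreover, (b) for any $\mathcal{M}$ factorization $T=WV^*$ for $T$ and for any orthonormal basis $\{u_n\}_{n\in\mathbb{N}}$ for $L^2$, the following formulae hold: $$\left(D_2^jD_1^i\boldsymbol{T}_\lambda\right)(s,t)=\sum_n\left[R_\lambda(T)Wu_n\right]^{(i)}(s)\,\overline{\left[Vu_n\right]^{(j)}(t)},\qquad (1)$$ $$\boldsymbol{t}_\lambda^{(i)}(s)=\sum_n\overline{\left[R_\lambda(T)Wu_n\right]^{(i)}(s)}\,Vu_n,\qquad \left(\boldsymbol{t}'_\lambda\right)^{(j)}(t)=\sum_n\overline{\left[Vu_n\right]^{(j)}(t)}\,R_\lambda(T)Wu_n,\qquad (2)$$ $$\left[T_\lambda f\right]^{(i)}(s)=\sum_n\left\langle f,Vu_n\right\rangle_{L^2}\left[R_\lambda(T)Wu_n\right]^{(i)}(s),\qquad (3)$$ for all non-negative integers $i,j$, all $s,t\in\mathbb{R}$, and all $f\in L^2$. Here the series of (1) converges $\mathbb{C}$-absolutely in $C(\mathbb{R}^2,\mathbb{C})$; the two series of (2), in which $\boldsymbol{t}_\lambda,\boldsymbol{t}'_\lambda$ denote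 the associated Carleman functions of $\boldsymbol{T}_\lambda$, both converge in $C(\mathbb{R},L^2)$; and the series of (3) converges $\mathbb{C}$-absolutely in $C(\mathbb{R},\mathbb{C})$.
   Context: $L^2=L^2(\mathbb{R})$ is the complex Hilbert space of (classes of) square-integrable functions with $\langle f,g\rangle_{L^2}=\int_{\mathbb{R}}f\overline{g}\,ds$. $\mathfrak{R}(L^2)$ is the algebra of bounded linear operators on $L^2$. $P\in\mathfrak{R}(L^2)$ is positive ($P\ge0$) if $\langle Px,x\rangle\ge0$ for all $x$. $\sum_n$ means $\sum_{n=1}^\infty$; $i,j$ denote non-negative integers. Families: for $T\in\mathfrak{R}(L^2)$, $$\mathcal{M}(T)=\left(T\mathfrak{R}(L^2)\cup T^*\mathfrak{R}(L^2)\right)\cap\left(\mathfrak{R}(L^2)T\cup\mathfrak{R}(L^2)T^*\right),\quad \mathcal{M}^+(T)=\{P\in\mathcal{M}(T)\mid P\ge0\},$$ where $S\mathfrak{R}(L^2)=\{SA\mid A\in\mathfrak{R}(L^2)\}$ and $\mathfrak{R}(L^2)S=\{AS\mid A\in\mathfrak{R}(L^2)\}$. An $\mathcal{M}$ factorization for $T$ is a factorization $T=WV^*$ with $V,W\in\mathfrak{R}(L^2)$ such that $VV^*\in\mathcal{M}^+(T)$ and $WW^*\in\mathcal{M}^+(T)$. Resolvents: $\Pi(T)$ (the set of regular values) is the set of $\lambda\in\mathbb{C}$ such that $I-\lambda T$ has an inverse $R_\lambda(T)=(I-\lambda T)^{-1}\in\mathfrak{R}(L^2)$. The Fredholm resolvent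 of $T$ at $\lambda\in\Pi(T)$ is $T_\lambda=TR_\lambda(T)=R_\lambda(T)T$. Integral operators: a linear operator $T\colon L^2\to L^2$ is integral with kernel $\boldsymbol{T}$ if $\boldsymbol{T}\colon\mathbb{R}^2\to\mathbb{C}$ is measurable and $(Tf)(s)=\int_{\mathbb{R}}\boldsymbol{T}(s,t)f(t)\,dt$ for every $f\in L^2$ and almost every $s$. A kernel $\boldsymbol{T}$ is Carleman if $\boldsymbol{T}(s,\cdot)\in L^2$ for almost every $s$; it is bi-Carleman if also $\boldsymbol{T}'(s,t)=\overline{\boldsymbol{T}(t,s)}$ is Carleman. The Carleman functions associated with a bi-Carleman kernel $\boldsymbol{T}$ are $\boldsymbol{t}(s)=\overline{\boldsymbol{T}(s,\cdot)}$ and $\boldsymbol{t}'(s)=\overline{\boldsymbol{T}'(s,\cdot)}=\boldsymbol{T}(\cdot,s)$, with values in $L^2$; those of $\boldsymbol{T}_\lambda$ are written $\boldsymbol{t}_\lambda$, $\boldsymbol{t}'_\lambda$. Function spaces: for a locally compact space $X$ and a Banach space $B$, $C(X,B)$ is the Banach space of continuous functions $X\to B$ vanishing at infinity, with the sup norm. A series $\sum_nf_n$ is $B$-absolutely convergent in $C(X,B)$ if all $f_n\in C(X,B)$ and $\sum_n\|f_n(x)\|_B$ converges in $C(X,\mathbb{R})$ (i.e. in sup norm). If the class $f\in L^2$ contains a function of $C(\mathbb{R},\mathbb{C})$, $[f]$ denotes that function and $[f]^{(i)}$ its $i$-th derivative, if it exists; the formulae include the assertion that the written functions exist. $D_r^i$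 is the $i$-th order partial derivative with respect to the $r$-th variable. A bi-Carleman kernel $\boldsymbol{T}\colon\mathbb{R}^2\to\mathbb{C}$ is a $K^\infty$ kernel if: (i) $\boldsymbol{T}$ and all its partial derivatives of all orders are in $C(\mathbb{R}^2,\mathbb{C})$; (ii) $\boldsymbol{t}$ and its strong (norm) derivatives $\boldsymbol{t}^{(i)}$ of all orders are in $C(\mathbb{R},L^2)$; (iii) $\boldsymbol{t}'$ and its strong derivatives $(\boldsymbol{t}')^{(i)}$ of all orders are in $C(\mathbb{R},L^2)$. A $K^\infty$ kernel $\boldsymbol{T}$ inducing the integral operator $T$ on $L^2$ is of Mercer type if every operator belonging to $\mathcal{M}(T)$ is an integral operator with a $K^\infty$ kernel. *)

(* Defs.v *)
From HB Require Import structures.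
From mathcomp Require Import all_boot all_order all_algebra.
From mathcomp Require Import generic_quotient complex.
From mathcomp Require Import all_classical all_reals all_analysis.
From mathcomp Require Import measurable_realfun.

Set Implicit Arguments.
Unset Strict Implicit.
Unset Printing Implicit Defensive.
Import Order.TTheory GRing.Theory Num.Theory.
Import numFieldNormedType.Exports.
Import Normc.

Local Open Scope classical_set_scope.
Local Open Scope ring_scope.
Local Open Scope quotient_scope.

(* [Rcomplex R] is the library's alias of [R[i]] seen as a real vector space,
   with the real-valued modulus [normc] as norm.  Its topology is the usual
   one on the complex plane; it is the Banach space in which limits and
   derivatives of complex-valued functions are taken. *)
Section RcomplexNormed.
Variable R : realType.

HB.instance Definition _ := PseudoMetric.copy (Rcomplex R)
  (pseudoMetric_normed (Rcomplex R)).
HB.instance Definition _ := isPointed.Build (Rcomplex R) 0.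
HB.instance Definition _ :=
  NormedZmod_PseudoMetric_eq.Build R (Rcomplex R) erefl.

Lemma Rcomplex_normrZ (l : R) (x : Rcomplex R) : `|l *: x| = `|l| * `|x|.
Proof.
case: x => a b; rewrite /Num.norm /= /normc /=.
by rewrite !exprMn -mulrDr sqrtrM ?sqr_ge0// sqrtr_sqr.
Qed.

HB.instance Definition _ :=
  PseudoMetricNormedZmod_Lmodule_isNormedModule.Build R (Rcomplex R)
    Rcomplex_normrZ.
End RcomplexNormed.

Section SquareIntegrable.
Variable R : realType.
Local Notation mu := (@lebesgue_measure R).

Definition cmeasurable d (X : measurableType d) (f : X -> R[i]) : Prop :=
  measurable_fun setT (fun x => complex.Re (f x)) /\
  measurable_fun setT (fun x => complex.Im (f x)).

(* Every Lebesgue measurable function agrees almost everywhere with a Borel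
   one, so Borel measurability yields the usual classes. *)
Definition square_integrable (f : R -> R[i]) : Prop :=
  cmeasurable (f : measurableTypeR R -> R[i]) /\
  finite_norm mu 2%:E (fun x => normc (f x)).

Definition L2norm_fun (f : R -> R[i]) : R :=
  fine ('N[mu]_2%:E[EFin \o (fun x => normc (f x))])%E.

Lemma normc_ge0 (z : R[i]) : 0 <= normc z.
Proof. by case: z => a b; rewrite sqrtr_ge0. Qed.

Lemma normcZ (a z : R[i]) : normc (a *: z) = normc a * normc z.
Proof. exact: normcM. Qed.

Lemma normc_measurable d (X : measurableType d) (f : X -> R[i]) :
  cmeasurable f -> measurable_fun setT (fun x => normc (f x)).
Proof.
move=> [mr mi]; rewrite (_ : (fun x => _) = (fun x =>
  Num.sqrt (complex.Re (f x) ^+ 2 + complex.Im (f x) ^+ 2))); last first.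
  by apply/funext => x; case: (f x).
apply: measurableT_comp; last first.
  by apply: measurable_funD; exact: measurable_funX.
by apply: continuous_measurable_fun; exact: sqrt_continuous.
Qed.

Lemma cmeasurableD d (X : measurableType d) (f g : X -> R[i]) :
  cmeasurable f -> cmeasurable g -> cmeasurable (fun x => f x + g x).
Proof.
move=> [fr fi] [gr gi]; split.
- rewrite (_ : (fun x => _) = (fun x => complex.Re (f x) + complex.Re (g x)));
    last by apply/funext => x; case: (f x) (g x) => [? ?] [? ?].
  exact: measurable_funD.
- rewrite (_ : (fun x => _) = (fun x => complex.Im (f x) + complex.Im (g x)));
    last by apply/funext => x; case: (f x) (g x) => [? ?] [? ?].
  exact: measurable_funD.
Qed.

Lemma cmeasurableZ d (X : measurableType d) (a : R[i]) (f : X -> R[i]) :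
  cmeasurable f -> cmeasurable (fun x => a *: f x).
Proof.
case: a => a b [fr fi]; split.
- rewrite (_ : (fun x => _) =
    (fun x => a * complex.Re (f x) - b * complex.Im (f x)));
    last by apply/funext => x; case: (f x) => [? ?].
  by apply: measurable_funB; exact: measurable_funM.
- rewrite (_ : (fun x => _) =
    (fun x => a * complex.Im (f x) + b * complex.Re (f x)));
    last by apply/funext => x; case: (f x) => [? ?].
  by apply: measurable_funD; exact: measurable_funM.
Qed.

Lemma le_Lnorm2 (f g : R -> R) :
  measurable_fun [set: measurableTypeR R] (f : measurableTypeR R -> R) ->
  measurable_fun [set: measurableTypeR R] (g : measurableTypeR R -> R) ->
  (forall x, `|f x| <= `|g x|) ->
  ('N[mu]_2%:E[EFin \o f] <= 'N[mu]_2%:E[EFin \o g])%E.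
Proof.
move=> mf mg fg; rewrite unlock /Lnorm.
have pm (h : R -> R) :
    measurable_fun [set: measurableTypeR R] (h : measurableTypeR R -> R) ->
    measurable_fun [set: measurableTypeR R]
      (fun x : measurableTypeR R => (`|(EFin \o h) x| `^ 2)%E).
  move=> mh; apply/measurable_EFinP.
  apply: (@measurableT_comp _ _ _ _ _ _ (fun x : R => x `^ 2)%R) => //.
  exact: measurableT_comp.
apply: gt0_ler_poweR; rewrite ?invr_ge0 ?ler0n//.
- by rewrite in_itv/= leey integral_ge0// => x _; exact: poweR_ge0.
- by rewrite in_itv/= leey integral_ge0// => x _; exact: poweR_ge0.
apply: ge0_le_integral => //.
- by move=> x _; exact: poweR_ge0.
- exact: pm.
- exact: pm.
- move=> x _ /=; rewrite lee_fin; apply: ge0_ler_powR; rewrite ?nnegrE//.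
Qed.

End SquareIntegrable.

Section L2fun.
Variable R : realType.
Local Notation mu := (@lebesgue_measure R).

#[export] Instance lebesgue_ae_filter : Filter (nbhs (almost_everywhere mu)) :=
  ae_filter_ringOfSetsType mu.

Definition sqint_pred : {pred R -> R[i]} :=
  fun f => `[< square_integrable f >].

Lemma L2norm_funE (f : R -> R[i]) : square_integrable f ->
  (L2norm_fun f)%:E = ('N[mu]_2%:E[EFin \o (fun x => normc (f x))])%E.
Proof.
move=> [_ ff]; rewrite /L2norm_fun fineK// fin_numElt.
apply/andP; split; last exact: ff.
exact: lt_le_trans (Lnorm_ge0 _ _ _).
Qed.

Lemma Lnorm2_normcD (f g : R -> R[i]) :
  cmeasurable (f : measurableTypeR R -> R[i]) ->
  cmeasurable (g : measurableTypeR R -> R[i]) ->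
  ('N[mu]_2%:E[EFin \o (fun x => normc (f x + g x)%R)] <=
   'N[mu]_2%:E[EFin \o (fun x => normc (f x))] +
   'N[mu]_2%:E[EFin \o (fun x => normc (g x))])%E.
Proof.
move=> mf mg.
have nf := normc_measurable mf; have ng := normc_measurable mg.
have nfg := normc_measurable (cmeasurableD mf mg).
apply: (@le_trans _ _
  ('N[mu]_2%:E[EFin \o ((fun x => normc (f x)) \+ (fun x => normc (g x)))%R])%E).
  apply: le_Lnorm2 => //; first exact: measurable_funD.
  move=> x; rewrite !ger0_norm ?addr_ge0 ?normc_ge0//.
  exact: (@le_normcD R (f x) (g x)).
by apply: eminkowski => //; rewrite lee_fin ler1n.
Qed.

Lemma Lnorm2_normcZ (a : R[i]) (f : R -> R[i]) : square_integrable f ->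
  ('N[mu]_2%:E[EFin \o (fun x => normc (a *: f x)%R)] =
   (normc a)%:E * 'N[mu]_2%:E[EFin \o (fun x => normc (f x))])%E.
Proof.
move=> [mf ff].
have Pf : (fun x => normc (f x)) \in Lfun mu 2%:E.
  by apply/andP; split; apply: mem_set => //=; exact: normc_measurable.
have p1 : (1 <= 2%:E :> \bar R)%E by rewrite lee_fin ler1n.
have := LnormZ (Lfun_Sub p1 Pf) (normc a).
rewrite ger0_norm ?normc_ge0// => <-; congr (Lnorm _ _ _).
by apply/funext => x /=; rewrite normcZ.
Qed.

Lemma sqint_submod_closed : submod_closed sqint_pred.
Proof.
split=> [|a f g /asboolP hf /asboolP hg]; apply/asboolP.
  split; first by split; exact: measurable_cst.
  have p0 : (2%:E != 0 :> \bar R)%E by rewrite eqe pnatr_eq0.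
  rewrite /finite_norm (_ : _ \o _ = cst 0%E) ?Lnorm0//.
  by apply/funext => x; congr (_%:E)%E; exact: normc0.
have [mf ff] := hf; have [mg fg] := hg.
have maf := cmeasurableZ a mf.
split; first exact: cmeasurableD.
apply: (le_lt_trans (Lnorm2_normcD maf mg)).
rewrite Lnorm2_normcZ// lte_add_pinfty// lte_mul_pinfty// lee_fin.
exact: normc_ge0.
Qed.

HB.instance Definition _ :=
  GRing.isSubmodClosed.Build R[i] (R -> R[i]) sqint_pred sqint_submod_closed.

Record sqfun := SqFun {
  sqfun_fun :> R -> R[i];
  sqfunP : sqfun_fun \in sqint_pred }.

HB.instance Definition _ := [isSub for sqfun_fun].
HB.instance Definition _ := [Choice of sqfun by <:].
HB.instance Definition _ := [SubChoice_isSubLmodule of sqfun by <:].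

Definition sqfun_eq (f g : sqfun) : bool :=
  `[< {ae mu, forall x, f x = g x} >].

Lemma sqfun_eq_refl : reflexive sqfun_eq.
Proof. by move=> f; apply/asboolP; exact: aeW. Qed.

Lemma sqfun_eq_sym : symmetric sqfun_eq.
Proof.
by move=> f g; apply/idP/idP => /asboolP h; apply/asboolP;
  apply: (filterS _ h) => x ->.
Qed.

Lemma sqfun_eq_trans : transitive sqfun_eq.
Proof.
move=> f g h /asboolP gf /asboolP fh; apply/asboolP.
by apply: (filterS2 _ _ gf fh) => x -> ->.
Qed.

Canonical sqfun_eq_equiv :=
  EquivRel sqfun_eq sqfun_eq_refl sqfun_eq_sym sqfun_eq_trans.

Definition L2 : Type := {eq_quot sqfun_eq}.
HB.instance Definition _ := Choice.on L2.
HB.instance Definition _ := EqQuotient.on L2.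

Definition L2repr (F : L2) : R -> R[i] := repr F : sqfun.
Coercion L2repr : L2 >-> Funclass.

Lemma L2piP (f g : sqfun) :
  {ae mu, forall x, f x = g x} <-> \pi_L2 f = \pi_L2 g.
Proof. by split=> [h|/eqmodP/asboolP//]; apply/eqmodP/asboolP. Qed.

Lemma L2repr_pi (f : sqfun) : {ae mu, forall x, L2repr (\pi_L2 f) x = f x}.
Proof. by apply/L2piP; rewrite reprK. Qed.

Definition L2add (F G : L2) : L2 := \pi_L2 (repr F + repr G : sqfun).
Definition L2opp (F : L2) : L2 := \pi_L2 (- repr F).
Definition L2scale (a : R[i]) (F : L2) : L2 := \pi_L2 (a *: repr F).

Lemma pi_L2add (f g : sqfun) : L2add (\pi_L2 f) (\pi_L2 g) = \pi_L2 (f + g).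
Proof.
apply/L2piP; have := L2repr_pi f; have := L2repr_pi g; rewrite /L2repr.
by apply: filterS2 => x gx fx; rewrite /= /GRing.add /= fx gx.
Qed.

Lemma pi_L2opp (f : sqfun) : L2opp (\pi_L2 f) = \pi_L2 (- f).
Proof.
apply/L2piP; have := L2repr_pi f; rewrite /L2repr.
by apply: filterS => x fx; rewrite /= /GRing.opp /= fx.
Qed.

Lemma pi_L2scale a (f : sqfun) : L2scale a (\pi_L2 f) = \pi_L2 (a *: f).
Proof.
apply/L2piP; have := L2repr_pi f; rewrite /L2repr.
by apply: filterS => x fx; rewrite /= /GRing.scale /= fx.
Qed.

Lemma L2_ind (P : L2 -> Prop) : (forall f : sqfun, P (\pi_L2 f)) -> forall F, P F.
Proof. by move=> h F; rewrite -[F]reprK. Qed.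

Lemma L2addA : associative L2add.
Proof.
elim/L2_ind => f; elim/L2_ind => g; elim/L2_ind => h.
by rewrite !pi_L2add addrA.
Qed.
Lemma L2addC : commutative L2add.
Proof.
by elim/L2_ind => f; elim/L2_ind => g; rewrite !pi_L2add addrC.
Qed.
Lemma L2add0 : left_id (\pi_L2 0) L2add.
Proof. by elim/L2_ind => f; rewrite !pi_L2add add0r. Qed.
Lemma L2addN : left_inverse (\pi_L2 0) L2opp L2add.
Proof. by elim/L2_ind => f; rewrite pi_L2opp pi_L2add addNr. Qed.

HB.instance Definition _ :=
  GRing.isZmodule.Build L2 L2addA L2addC L2add0 L2addN.

Lemma pi_L2D (f g : sqfun) : \pi_L2 f + \pi_L2 g = \pi_L2 (f + g).
Proof. exact: pi_L2add. Qed.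

Lemma L2scaleA a b F : L2scale a (L2scale b F) = L2scale (a * b) F.
Proof. by elim/L2_ind: F => f; rewrite !pi_L2scale scalerA. Qed.
Lemma L2scale1 : left_id 1 L2scale.
Proof. by elim/L2_ind => f; rewrite pi_L2scale scale1r. Qed.
Lemma L2scaleDr : right_distributive L2scale +%R.
Proof.
move=> a; elim/L2_ind => f; elim/L2_ind => g.
by rewrite pi_L2D !pi_L2scale pi_L2D scalerDr.
Qed.
Lemma L2scaleDl F : {morph L2scale^~ F : a b / a + b}.
Proof.
elim/L2_ind: F => f a b.
by rewrite !pi_L2scale pi_L2D scalerDl.
Qed.

HB.instance Definition _ := GRing.Zmodule_isLmodule.Build R[i] L2
  L2scaleA L2scale1 L2scaleDr L2scaleDl.

Lemma pi_L2Z a (f : sqfun) : a *: \pi_L2 f = \pi_L2 (a *: f).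
Proof. exact: pi_L2scale. Qed.

Definition L2norm (F : L2) : R := L2norm_fun F.

Lemma L2reprP (F : L2) : square_integrable F.
Proof. by have /asboolP := sqfunP (repr F). Qed.

Lemma eq_L2norm_fun (f g : sqfun) :
  {ae mu, forall x, f x = g x} -> L2norm_fun f = L2norm_fun g.
Proof.
move=> fg; rewrite /L2norm_fun; congr fine.
have /asboolP [mf _] := sqfunP f; have /asboolP [mg _] := sqfunP g.
rewrite unlock /Lnorm; congr (_ `^ _)%E; apply: ae_eq_integral => //.
- apply/measurable_EFinP.
  apply: (@measurableT_comp _ _ _ _ _ _ (fun x : R => x `^ 2)%R) => //.
  by apply: measurableT_comp => //; exact: normc_measurable.
- apply/measurable_EFinP.
  apply: (@measurableT_comp _ _ _ _ _ _ (fun x : R => x `^ 2)%R) => //.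
  by apply: measurableT_comp => //; exact: normc_measurable.
- by move: fg; apply: filterS => x fgx _ /=; rewrite fgx.
Qed.

Lemma L2norm_pi (f : sqfun) : L2norm (\pi_L2 f) = L2norm_fun f.
Proof. by apply: eq_L2norm_fun; exact: L2repr_pi. Qed.

Lemma L2normD (F G : L2) : L2norm (F + G) <= L2norm F + L2norm G.
Proof.
elim/L2_ind: F => f; elim/L2_ind: G => g.
rewrite pi_L2D !L2norm_pi -lee_fin EFinD.
have /asboolP hf := sqfunP f; have /asboolP hg := sqfunP g.
have /asboolP hfg := sqfunP (f + g).
by rewrite !L2norm_funE//; apply: Lnorm2_normcD; [case: hf|case: hg].
Qed.

Lemma L2normZ (a : R[i]) (F : L2) : L2norm (a *: F) = normc a * L2norm F.
Proof.
elim/L2_ind: F => f; rewrite pi_L2Z !L2norm_pi.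
have /asboolP hf := sqfunP f; have /asboolP haf := sqfunP (a *: f).
by apply: EFin_inj; rewrite EFinM !L2norm_funE// Lnorm2_normcZ.
Qed.

Lemma L2norm_eq0 (F : L2) : L2norm F = 0 -> F = 0.
Proof.
elim/L2_ind: F => f; rewrite L2norm_pi => f0; apply/L2piP.
have /asboolP hf := sqfunP f.
have mf : measurable_fun setT
    (EFin \o (fun x : measurableTypeR R => normc (f x))).
  by apply/measurable_EFinP/normc_measurable; case: hf.
have p0 : (0 < 2%:E :> \bar R)%E by rewrite lte_fin ltr0n.
have := L2norm_funE hf; rewrite f0 => /esym/(Lnorm_eq0_eq0 mf p0).
by apply: filterS => x /(_ I) [] /eq0_normc.
Qed.

End L2fun.

(* [RL2 R] is to [L2 R] what [Rcomplex R] is to [R[i]]: the same vectors, seen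
   as a real normed space.  Limits, continuity and strong derivatives of
   L^2-valued functions are taken there. *)
Definition RL2 (R : realType) : Type := L2 R.

Section RL2.
Variable R : realType.
HB.instance Definition _ := GRing.Zmodule.on (RL2 R).

Definition RL2scale (a : R) (F : RL2 R) : RL2 R := a%:C%C *: (F : L2 R).

Lemma RL2scaleA a b F : RL2scale a (RL2scale b F) = RL2scale (a * b) F.
Proof. by rewrite /RL2scale scalerA -rmorphM. Qed.
Lemma RL2scale1 : left_id 1 RL2scale.
Proof. by move=> F; rewrite /RL2scale rmorph1 scale1r. Qed.
Lemma RL2scaleDr : right_distributive RL2scale +%R.
Proof. by move=> a F G; rewrite /RL2scale scalerDr. Qed.
Lemma RL2scaleDl F : {morph RL2scale^~ F : a b / a + b}.
Proof. by move=> a b; rewrite /RL2scale rmorphD scalerDl. Qed.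

HB.instance Definition _ := GRing.Zmodule_isLmodule.Build R (RL2 R)
  RL2scaleA RL2scale1 RL2scaleDr RL2scaleDl.

Lemma RL2normZ (a : R) (F : RL2 R) : L2norm (a *: F) = `|a| * L2norm F.
Proof.
by rewrite L2normZ /normc/= expr0n/= addr0 sqrtr_sqr.
Qed.

HB.instance Definition _ := @Lmodule_isNormed.Build R (RL2 R)
  (@L2norm R) (@L2normD R) RL2normZ (@L2norm_eq0 R).
End RL2.

Section L2inner.
Variable R : realType.
Local Notation mu := (@lebesgue_measure R).

Definition cintegrable (f : R -> R[i]) : Prop :=
  mu.-integrable setT (fun x => (complex.Re (f x))%:E) /\
  mu.-integrable setT (fun x => (complex.Im (f x))%:E).

Definition cintegral (f : R -> R[i]) : R[i] :=
  Complex (\int[mu]_x complex.Re (f x)) (\int[mu]_x complex.Im (f x)).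

Definition L2inner (F G : L2 R) : R[i] :=
  cintegral (fun x => F x * conjc (G x)).

(* The default value 0 is used only when [h] is not square integrable. *)
Definition L2class (h : R -> R[i]) : L2 R := \pi_(L2 R) (insubd 0 h).

Definition in_class (F : L2 R) (h : R -> R[i]) : Prop :=
  {ae mu, forall x, F x = h x}.

Definition orthonormal_basis (u : nat -> L2 R) : Prop :=
  (forall m n, L2inner (u m) (u n) = (m == n)%:R) /\
  forall F : L2 R,
    series (fun n => L2inner F (u n) *: u n : RL2 R) @ \oo --> (F : RL2 R).

End L2inner.

Section Operators.
Variable R : realType.
Local Notation op := (L2 R -> L2 R).
Implicit Types A P S T V W : op.

Definition bounded_operator : set op := [set A | linear A /\
  exists M : R, forall F, L2norm (A F) <= M * L2norm F].

Definition is_adjoint T S : Prop := bounded_operator S /\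
  forall F G, L2inner (T F) G = L2inner F (S G).

(* Every bounded operator has exactly one adjoint, by the Riesz representation
   theorem; the default value is never used on bounded operators. *)
Definition adjoint T : op := xget (fun=> 0) [set S | is_adjoint T S].

Definition positive P : Prop :=
  bounded_operator P /\ forall F, 0 <= L2inner (P F) F.

Definition right_multiples S : set op := [set S \o A | A in bounded_operator].
Definition left_multiples S : set op := [set A \o S | A in bounded_operator].

Definition Mfamily T : set op :=
  (right_multiples T `|` right_multiples (adjoint T)) `&`
  (left_multiples T `|` left_multiples (adjoint T)).

Definition Mfamily_pos T : set op := Mfamily T `&` [set P | positive P].

(* T = W V^*, with W given first. *)
Definition M_factorization T W V : Prop :=
  [/\ bounded_operator V, bounded_operator W, T = W \o adjoint V,
      Mfamily_pos T (V \o adjoint V) & Mfamily_pos T (W \o adjoint W)].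

Definition is_resolvent T (l : R[i]) S : Prop :=
  [/\ bounded_operator S,
      forall F, S F - l *: T (S F) = F &
      forall F, S (F - l *: T F) = F].

Definition regular_values T : set R[i] :=
  [set l | exists S, is_resolvent T l S].

(* Meaningful for [l] in [regular_values T] only, where the inverse is unique. *)
Definition resolvent T (l : R[i]) : op :=
  xget (fun=> 0) [set S | is_resolvent T l S].

Definition fredholm_resolvent T (l : R[i]) : op := T \o resolvent T l.

End Operators.

Section C0.
Variables (R : realType) (X : topologicalType) (B : normedModType R).

Definition C0 (f : X -> B) : Prop := continuous f /\
  forall e : R, 0 < e ->
    exists2 K : set X, compact K & forall x, ~ K x -> `|f x| < e.

Definition series_cvg_C0 (f : nat -> X -> B) (F : X -> B) : Prop :=
  [/\ forall n, C0 (f n), C0 F &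
      {uniform, (fun N x => series (f ^~ x) N) @ \oo --> F}].

End C0.

Definition series_abscvg_C0 (R : realType) (X : topologicalType)
    (B : normedModType R) (f : nat -> X -> B) : Prop :=
  (forall n, C0 (f n)) /\
  exists g : X -> R^o, series_cvg_C0 (fun n x => `|f n x| : R^o) g.

Definition derivatives_exist (R : realType) (B : normedModType R)
    (f : R -> B) : Prop :=
  forall (i : nat) (x : R), derivable (derive1n i f) x 1.

Definition smooth_C0 (R : realType) (B : normedModType R) (f : R -> B) : Prop :=
  derivatives_exist f /\ forall i : nat, C0 (derive1n i f).

Section ContinuousRepresentative.
Variable R : realType.

Definition is_crep (F : L2 R) (h : R -> Rcomplex R) : Prop :=
  C0 h /\ in_class F h.

(* The function written [F] in square brackets; it is unique when it exists,
   and its existence is asserted separately through [has_smooth_crep]. *)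
Definition crep (F : L2 R) : R -> Rcomplex R :=
  xget (fun=> 0) [set h | is_crep F h].

Definition has_smooth_crep (F : L2 R) : Prop :=
  is_crep F (crep F) /\ derivatives_exist (crep F).

End ContinuousRepresentative.

Section Kernels.
Variable R : realType.
Local Notation mu := (@lebesgue_measure R).
Local Notation kernel := (R -> R -> Rcomplex R).
Implicit Types K : kernel.

Definition kernel_measurable K : Prop :=
  cmeasurable (fun p : measurableTypeR R * measurableTypeR R =>
    (K p.1 p.2 : R[i])).

Definition integral_operator (T : L2 R -> L2 R) K : Prop :=
  kernel_measurable K /\
  forall F : L2 R, {ae mu, forall s,
    cintegrable (fun t => (K s t : R[i]) * F t) /\
    T F s = cintegral (fun t => (K s t : R[i]) * F t)}.

Definition conj_transpose K : kernel := fun s t => conjc (K t s).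

Definition carleman K : Prop :=
  kernel_measurable K /\ {ae mu, forall s, square_integrable (K s)}.

Definition bi_carleman K : Prop := carleman K /\ carleman (conj_transpose K).

Definition carleman_fun K : R -> RL2 R :=
  fun s => L2class (fun t => conjc (K s t)).

Definition carleman_fun' K : R -> RL2 R := carleman_fun (conj_transpose K).

Definition D1 K : kernel := fun s t => derive1 (K ^~ t) s.
Definition D2 K : kernel := fun s t => derive1 (K s) t.

(* [w] lists the successive variables of differentiation: [true] for the
   second variable, [false] for the first one. *)
Definition partial (w : seq bool) K : kernel :=
  foldr (fun second => if second then D2 else D1) K w.

Definition smooth_kernel K : Prop := forall w : seq bool,
  [/\ forall s t, derivable (partial w K ^~ t) s 1,
      forall s t, derivable (partial w K s) t 1 &
      C0 (fun p : R * R => partial w K p.1 p.2)].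

(* The Carleman functions must take values in L^2 everywhere, not only almost
   everywhere, in order to be elements of C(R, L^2). *)
Definition Kinfty_kernel K : Prop :=
  [/\ bi_carleman K,
      smooth_kernel K,
      (forall s, square_integrable (K s)) /\ smooth_C0 (carleman_fun K) &
      (forall s, square_integrable (conj_transpose K s)) /\
        smooth_C0 (carleman_fun' K)].

Definition mercer_kernel (T : L2 R -> L2 R) K : Prop :=
  [/\ Kinfty_kernel K, integral_operator T K &
      forall A, Mfamily T A ->
        exists2 KA, Kinfty_kernel KA & integral_operator A KA].

End Kernels.

(* Main.v *)
(* Since T_l = T R_l = R_l T, the family M contains T_l and shrinks when T is
   replaced by T_l; this gives (a).  For (b), T = W V^* and the operators V V^*
   and W W^* have smooth kernels.  A kernel K of V V^* is a Gram matrix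
   K(t, s) = <v(s), v(t)>, where v(s) is the limit of V^* delta for normalized
   indicators delta of balls shrinking to s, so that (V f)(s) = <f, v(s)>; a curve
   in a Hilbert space with a smooth Gram matrix is itself smooth, and the decay of
   K on the diagonal makes v vanish at infinity.  The same holds for W, hence for
   R_l W = W (I + l V^* R_l W), which gets a curve a with (R_l W f)(s) = <f, a(s)>.
   Then T_l(s, t) = <v(t), a(s)>, and all the formulae are expansions of a and v
   in the basis u, which converge uniformly because a curve vanishing at infinity
   has relatively compact range. *)
Require Import Defs.
From HB Require Import structures.
From mathcomp Require Import all_boot all_order all_algebra.
From mathcomp Require Import generic_quotient complex.
From mathcomp Require Import all_classical all_reals all_analysis.
From mathcomp Require Import measurable_realfun.
From mathcomp Require Import ring lra.
Set Implicit Arguments.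
Unset Strict Implicit.
Unset Printing Implicit Defensive.
Import Order.TTheory GRing.Theory Num.Theory.
Import numFieldNormedType.Exports.
Import Normc.
Local Open Scope classical_set_scope.
Local Open Scope ring_scope.
Local Open Scope quotient_scope.

(** Membership in [Mfamily] gives smooth kernels to the two positive products only; [V] and [W]
    themselves need not lie in the family, and the curves replace the kernels that they may lack. A
    Gram matrix suffices to build the curves because |x - y|^2 = <x,x> - 2 Re <x,y> + <y,y>: when
    the three products tend to one number, x - y tends to 0. This estimate and the completeness of
    L^2 give both the limit that defines a curve and its strong derivatives. It is also why only
    real parts of kernels are followed there.

    A curve that represents the point evaluations of [A] yields one for [A \o B], by applying
    [adjoint B], but none for [B \o A]. The resolvent stands to the left of [W], so it has to be
    moved to the right before the curve of [W] can be used.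

    Elements of L^2 have values only almost everywhere, and the null set on which a kernel formula
    may fail depends on the function it is applied to. Such identities are first proved almost
    everywhere, for a fixed function, and then made to hold everywhere by continuity; this is how an
    arbitrary smooth kernel of the resolvent is identified. *)

Local Notation Re := complex.Re.
Local Notation Im := complex.Im.

(** * Real and imaginary parts, conjugation and modulus *)

Section ComplexParts.
Variable R : realType.
Implicit Types z w : R[i].

Lemma cReD z w : Re (z + w) = Re z + Re w. Proof. by case: z w => [? ?] []. Qed.
Lemma cImD z w : Im (z + w) = Im z + Im w. Proof. by case: z w => [? ?] []. Qed.
Lemma cReN z : Re (- z) = - Re z. Proof. by case: z. Qed.
Lemma cImN z : Im (- z) = - Im z. Proof. by case: z. Qed.
Lemma cReM z w : Re (z * w) = Re z * Re w - Im z * Im w.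
Proof. by case: z w => [? ?] []. Qed.
Lemma cImM z w : Im (z * w) = Re z * Im w + Im z * Re w.
Proof. by case: z w => [? ?] []. Qed.
Lemma cReconj z : Re (conjc z) = Re z. Proof. by case: z. Qed.
Lemma cImconj z : Im (conjc z) = - Im z. Proof. by case: z. Qed.
Lemma complex_eqP z w : Re z = Re w -> Im z = Im w -> z = w.
Proof. by case: z w => [a b] [c d] /= -> ->. Qed.

Lemma normc_sqr z : normc z ^+ 2 = Re z ^+ 2 + Im z ^+ 2.
Proof. by case: z => a b; rewrite /= sqr_sqrtr// addr_ge0// sqr_ge0. Qed.

Lemma Re_le_normc z : `|Re z| <= normc z.
Proof.
rewrite -[leLHS]ger0_norm// -ler_sqr ?nnegrE ?normc_ge0// ger0_norm//.
by rewrite normc_sqr real_normK ?num_real// lerDl sqr_ge0.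
Qed.

Lemma Im_le_normc z : `|Im z| <= normc z.
Proof.
rewrite -[leLHS]ger0_norm// -ler_sqr ?nnegrE ?normc_ge0// ger0_norm//.
by rewrite normc_sqr real_normK ?num_real// lerDr sqr_ge0.
Qed.

Lemma normc_conj z : normc (conjc z) = normc z.
Proof. by case: z => a b; rewrite /= sqrrN. Qed.

Lemma cRe_realM (t : R) z : Re (t%:C%C * z) = t * Re z.
Proof. by rewrite cReM /= mul0r subr0. Qed.

Lemma normc_real (t : R) : normc t%:C%C = `|t|.
Proof. by rewrite /= expr0n/= addr0 sqrtr_sqr. Qed.

End ComplexParts.

(** * The inner product of L^2 *)

Section SquareIntegrableParts.
Variable R : realType.
Local Notation mu := (@lebesgue_measure R).
Local Notation Lf := (Lfun mu 2%:E).

Lemma square_integrable_ReIm (f : R -> R[i]) : square_integrable f ->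
  (fun x => Re (f x)) \in Lf /\ (fun x => Im (f x)) \in Lf.
Proof.
move=> [[mr mi] ff]; split; apply/andP; split; rewrite inE//=.
- apply: le_lt_trans ff; apply: le_Lnorm2 => //; first exact: normc_measurable.
  by move=> x; rewrite (ger0_norm (normc_ge0 _)); exact: Re_le_normc.
- apply: le_lt_trans ff; apply: le_Lnorm2 => //; first exact: normc_measurable.
  by move=> x; rewrite (ger0_norm (normc_ge0 _)); exact: Im_le_normc.
Qed.

Lemma square_integrableP (f : R -> R[i]) :
  cmeasurable (f : measurableTypeR R -> R[i]) ->
  mu.-integrable setT (fun x => (normc (f x) ^+ 2)%:E) ->
  square_integrable f.
Proof.
move=> mf /integrableP ifi; have [_ fi] := ifi; split=> //.
rewrite /finite_norm unlock /Lnorm poweR_lty//.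
apply: le_lt_trans fi; apply: ge0_le_integral => //=.
- apply/measurable_EFinP.
  apply: (@measurableT_comp _ _ _ _ _ _ (fun x : R => x `^ 2)%R) => //.
  by apply: measurableT_comp => //; exact: normc_measurable.
- apply/measurable_EFinP; apply: measurableT_comp => //.
  by apply: measurable_funX; exact: normc_measurable.
- move=> x _; rewrite lee_fin (ger0_norm (normc_ge0 _)) (ger0_norm (sqr_ge0 _)).
  by rewrite powR_mulrn ?normc_ge0.
Qed.

Lemma L2norm_fun_sqr (f : R -> R[i]) : square_integrable f ->
  L2norm_fun f ^+ 2 = \int[mu]_x (normc (f x) ^+ 2).
Proof.
move=> sf; apply: EFin_inj.
have := L2norm_funE sf => e.
rewrite /Rintegral fineK; last first.
  apply: integrable_fin_num => //.
  have h : (fun x => normc (f x)) \in Lf.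
    by case: sf => mf ff; apply/andP; split; rewrite inE//; exact: normc_measurable.
  exact: Lfun2_integrable_sqr h.
rewrite -powR_mulrn; last by rewrite -lee_fin e Lnorm_ge0.
rewrite -poweR_EFin e powR_Lnorm//.
by apply: eq_integral => x _; rewrite /= powR_mulrn// real_normK// num_real.
Qed.

Lemma cintegrable_mul_conj (f g : R -> R[i]) :
  square_integrable f -> square_integrable g ->
  cintegrable (fun x => f x * conjc (g x)).
Proof.
move=> /square_integrable_ReIm[fr fi] /square_integrable_ReIm[gr gi].
have h a b : a \in Lf -> b \in Lf -> mu.-integrable setT (EFin \o (a \* b)).
  by move=> ha hb; apply/Lfun1_integrable; exact: Lfun2_mul_Lfun1.
split.
- rewrite (_ : (fun x => _) = ((EFin \o ((fun x => Re (f x)) \* (fun x => Re (g x)))%R) \+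
     (EFin \o ((fun x => Im (f x)) \* (fun x => Im (g x)))%R))%E); last first.
    by apply/funext => x; rewrite /= cReM cReconj cImconj mulrN opprK EFinD.
  by apply: integrableD => //; exact: h.
- rewrite (_ : (fun x => _) = ((EFin \o ((fun x => Im (f x)) \* (fun x => Re (g x)))%R) \-
     (EFin \o ((fun x => Re (f x)) \* (fun x => Im (g x)))%R))%E); last first.
    by apply/funext => x; rewrite /= cImM cReconj cImconj mulrN addrC EFinB.
  by apply: integrableB => //; exact: h.
Qed.

Lemma cintegralD (f g : R -> R[i]) : cintegrable f -> cintegrable g ->
  cintegral (fun x => f x + g x) = cintegral f + cintegral g.
Proof.
move=> [fr fi] [gr gi]; apply: complex_eqP; rewrite /=.
- by under eq_Rintegral do rewrite cReD; rewrite RintegralD.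
- by under eq_Rintegral do rewrite cImD; rewrite RintegralD.
Qed.

Lemma cintegralZ a (f : R -> R[i]) : cintegrable f ->
  cintegral (fun x => a * f x) = a * cintegral f.
Proof.
move=> [fr fi].
have iZ (c : R) (h : R -> R) : mu.-integrable setT (fun x => (h x)%:E) ->
    mu.-integrable setT (EFin \o (fun x => c * h x)).
  by move=> ih; rewrite /comp; under eq_fun do rewrite EFinM; exact: integrableZl.
apply: complex_eqP; rewrite /= ?cReM ?cImM /=.
- under eq_Rintegral do rewrite cReM.
  by rewrite RintegralB ?RintegralZl//; exact: iZ.
- under eq_Rintegral do rewrite cImM.
  by rewrite RintegralD ?RintegralZl//; exact: iZ.
Qed.

Lemma ae_eq_Rintegral (f g : R -> R) : 
  measurable_fun [set: measurableTypeR R] (f : measurableTypeR R -> R) ->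
  measurable_fun [set: measurableTypeR R] (g : measurableTypeR R -> R) ->
  {ae mu, forall x, f x = g x} -> \int[mu]_x f x = \int[mu]_x g x.
Proof.
move=> mf mg fg; congr fine; apply: ae_eq_integral => //; [exact/measurable_EFinP..|].
by apply: filterS fg => x /= ->.
Qed.

Lemma ae_eq_cintegral (f g : R -> R[i]) :
  cmeasurable (f : measurableTypeR R -> R[i]) ->
  cmeasurable (g : measurableTypeR R -> R[i]) ->
  {ae mu, forall x, f x = g x} -> cintegral f = cintegral g.
Proof.
move=> [mf mf'] [mg mg'] fg.
by congr Complex; apply: ae_eq_Rintegral => //; apply: filterS fg => x /= ->.
Qed.

Lemma ae_eq_integrable (f g : R -> R) :
  measurable_fun [set: measurableTypeR R] (g : measurableTypeR R -> R) ->
  {ae mu, forall x, f x = g x} ->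
  mu.-integrable setT (EFin \o f) -> mu.-integrable setT (EFin \o g).
Proof.
move=> mg fg /integrableP ifi; have [mf fi] := ifi.
have mg' : measurable_fun [set: measurableTypeR R] (EFin \o g).
  exact/measurable_EFinP.
apply/integrableP; split=> //; move: fi; congr (_ < _)%E.
apply: ae_eq_integral => //; [exact: measurableT_comp..|].
by apply: filterS fg => x /= ->.
Qed.

Lemma cmeasurableM d (X : measurableType d) (f g : X -> R[i]) :
  cmeasurable f -> cmeasurable g -> cmeasurable (fun x => f x * g x).
Proof.
move=> [fr fi] [gr gi]; split.
- under eq_fun do rewrite cReM; apply: measurable_funB; exact: measurable_funM.
- under eq_fun do rewrite cImM; apply: measurable_funD; exact: measurable_funM.
Qed.

Lemma cmeasurable_conj d (X : measurableType d) (f : X -> R[i]) :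
  cmeasurable f -> cmeasurable (fun x => conjc (f x)).
Proof.
move=> [fr fi]; split.
- by under eq_fun do rewrite cReconj.
- by under eq_fun do rewrite cImconj; exact: measurableT_comp.
Qed.

Lemma L2_cmeasurable (F : L2 R) : cmeasurable (F : measurableTypeR R -> R[i]).
Proof. by case: (L2reprP F). Qed.

End SquareIntegrableParts.

Section InnerProduct.
Variable R : realType.
Local Notation mu := (@lebesgue_measure R).
Implicit Types F G H : L2 R.

Lemma L2reprD F G : {ae mu, forall x, (F + G : L2 R) x = F x + G x}.
Proof. exact: (L2repr_pi (repr F + repr G)). Qed.

Lemma L2reprZ a F : {ae mu, forall x, (a *: F : L2 R) x = a * F x}.
Proof. exact: (L2repr_pi (a *: repr F)). Qed.

Lemma L2ext F G : {ae mu, forall x, F x = G x} -> F = G.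
Proof.
by move=> h; rewrite -[F]reprK -[G]reprK; apply/L2piP.
Qed.

Lemma L2_cintegrable F G : cintegrable (fun x => F x * conjc (G x)).
Proof. by apply: cintegrable_mul_conj; exact: L2reprP. Qed.

Lemma L2_cmeasurable_mul F G :
  cmeasurable ((fun x => F x * conjc (G x)) : measurableTypeR R -> R[i]).
Proof.
apply: cmeasurableM; first exact: L2_cmeasurable.
by apply: cmeasurable_conj; exact: L2_cmeasurable.
Qed.

Lemma L2innerDl F G H : L2inner (F + G) H = L2inner F H + L2inner G H.
Proof.
rewrite /L2inner -cintegralD; [|exact: L2_cintegrable..].
apply: ae_eq_cintegral; first exact: L2_cmeasurable_mul.
  by apply: cmeasurableD; exact: L2_cmeasurable_mul.
by apply: filterS (L2reprD F G) => x ->; rewrite mulrDl.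
Qed.

Lemma L2innerZl a F G : L2inner (a *: F) G = a * L2inner F G.
Proof.
rewrite /L2inner -cintegralZ; last exact: L2_cintegrable.
apply: ae_eq_cintegral; first exact: L2_cmeasurable_mul.
  by apply: cmeasurableZ; exact: L2_cmeasurable_mul.
by apply: filterS (L2reprZ a F) => x ->; rewrite mulrA.
Qed.

Lemma cintegral_conj (f : R -> R[i]) : cintegrable f ->
  cintegral (fun x => conjc (f x)) = conjc (cintegral f).
Proof.
move=> [fr fi]; apply: complex_eqP; rewrite /=.
  by under eq_Rintegral do rewrite cReconj.
under eq_Rintegral do rewrite cImconj -mulN1r.
by rewrite RintegralZl// mulN1r.
Qed.

Lemma L2innerC F G : L2inner G F = conjc (L2inner F G).
Proof.
rewrite /L2inner -cintegral_conj; last exact: L2_cintegrable.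
by congr cintegral; apply/funext => x; rewrite rmorphM /= conjcK mulrC.
Qed.

Lemma L2inner_norm F : L2inner F F = (L2norm F ^+ 2)%:C%C.
Proof.
rewrite (L2norm_fun_sqr (L2reprP F)) /L2inner /cintegral.
congr Complex.
  by apply: eq_Rintegral => x _; rewrite cReM cReconj cImconj mulrN opprK normc_sqr !expr2.
rewrite (_ : (fun x => _) = cst 0).
  by rewrite Rintegral_cst// mul0r.
by apply/funext => x; rewrite cImM cReconj cImconj mulrN mulrC addNr.
Qed.

Lemma L2innerDr F G H : L2inner F (G + H) = L2inner F G + L2inner F H.
Proof. by rewrite L2innerC L2innerDl rmorphD (L2innerC G F) (L2innerC H F). Qed.

Lemma L2innerZr a F G : L2inner F (a *: G) = conjc a * L2inner F G.
Proof. by rewrite L2innerC L2innerZl rmorphM (L2innerC G F). Qed.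

Lemma L2innerNl F G : L2inner (- F) G = - L2inner F G.
Proof. by rewrite -scaleN1r L2innerZl mulN1r. Qed.

Lemma L2innerNr F G : L2inner F (- G) = - L2inner F G.
Proof. by rewrite L2innerC L2innerNl rmorphN (L2innerC G F). Qed.

Lemma L2innerBl F G H : L2inner (F - G) H = L2inner F H - L2inner G H.
Proof. by rewrite L2innerDl L2innerNl. Qed.

Lemma L2innerBr F G H : L2inner F (G - H) = L2inner F G - L2inner F H.
Proof. by rewrite L2innerDr L2innerNr. Qed.

Lemma L2inner0l F : L2inner 0 F = 0.
Proof. by rewrite -(scale0r 0) L2innerZl mul0r. Qed.

Lemma L2inner0r F : L2inner F 0 = 0.
Proof. by rewrite L2innerC L2inner0l rmorph0. Qed.

Lemma L2inner_suml (I : Type) (r : seq I) (P : pred I) (f : I -> L2 R) G :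
  L2inner (\sum_(i <- r | P i) f i) G = \sum_(i <- r | P i) L2inner (f i) G.
Proof.
by apply: (big_morph (fun F => L2inner F G)) => [F H|]; rewrite ?L2innerDl ?L2inner0l.
Qed.

Lemma L2norm_ge0 F : 0 <= L2norm F.
Proof. exact: (normr_ge0 (F : RL2 R)). Qed.

Lemma L2normN F : L2norm (- F) = L2norm F.
Proof. exact: (normrN (F : RL2 R)). Qed.

Lemma L2norm0 : L2norm (0 : L2 R) = 0.
Proof. exact: (normr0 (RL2 R)). Qed.

Lemma L2normB F G : L2norm (F - G) = L2norm (G - F).
Proof. exact: (distrC (F : RL2 R)). Qed.

Lemma L2norm_sqr F : L2norm F ^+ 2 = Re (L2inner F F).
Proof. by rewrite L2inner_norm. Qed.

Lemma L2norm_sqrD F G :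
  L2norm (F + G) ^+ 2 = L2norm F ^+ 2 + 2 * Re (L2inner F G) + L2norm G ^+ 2.
Proof.
rewrite !L2norm_sqr L2innerDl !L2innerDr !cReD (L2innerC F G) cReconj.
by ring.
Qed.

Lemma L2norm_sqrB F G :
  L2norm (F - G) ^+ 2 = L2norm F ^+ 2 - 2 * Re (L2inner F G) + L2norm G ^+ 2.
Proof. by rewrite L2norm_sqrD L2normN L2innerNr cReN mulrN. Qed.

Lemma L2_cauchy_schwarz F G : normc (L2inner F G) <= L2norm F * L2norm G.
Proof.
rewrite -ler_sqr ?nnegrE ?normc_ge0 ?mulr_ge0 ?L2norm_ge0// exprMn.
have [g0|g0] := eqVneq (L2norm G) 0.
  by rewrite (L2norm_eq0 g0) L2inner0r normc0 L2norm0 expr0n/= mulr0.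
(* With the [c] and [t] set below, [t c G] is the orthogonal projection of [F] onto the line of [G].
   The squared length of the rest is |F|^2 - t |c|^2, and its being nonnegative is the claim. *)
have gp : 0 < L2norm G ^+ 2 by rewrite exprn_gt0// lt0r g0 L2norm_ge0.
set c := L2inner F G; pose t := (L2norm G ^+ 2)^-1.
have := sqr_ge0 (L2norm (F - (t%:C%C * c) *: G)).
rewrite L2norm_sqrB L2innerZr L2normZ normcM -/c.
have -> : normc t%:C%C = t.
  by rewrite /= expr0n/= addr0 sqrtr_sqr ger0_norm// invr_ge0 ltW.
have -> : Re (conjc (t%:C%C * c) * c) = t * normc c ^+ 2.
  by rewrite normc_sqr; case: (c) => a b /=; ring.
rewrite !exprMn => h.
rewrite -ler_pdivrMr// -/t.
have e : t ^+ 2 * normc c ^+ 2 * L2norm G ^+ 2 = t * normc c ^+ 2.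
  have tg : t * L2norm G ^+ 2 = 1 by rewrite mulVf ?gt_eqF.
  rewrite -[RHS]mulr1 -tg; ring.
by move: h; rewrite e [_ / _]mulrC -/t; lra.
Qed.

Lemma Re_L2inner_le F G : `|Re (L2inner F G)| <= L2norm F * L2norm G.
Proof. exact: le_trans (Re_le_normc _) (L2_cauchy_schwarz _ _). Qed.

Lemma L2inner_inj F G : (forall H, L2inner H F = L2inner H G) -> F = G.
Proof.
move=> h; apply/eqP; rewrite -subr_eq0; apply/eqP/L2norm_eq0/eqP.
by rewrite -sqrf_eq0 L2norm_sqr L2innerBr h subrr.
Qed.

End InnerProduct.

(** * Completeness of L^2 *)

Section Completeness.
Variable R : realType.
Local Notation mu := (@lebesgue_measure R).

(** The increments form an absolutely convergent series, and [r] is its telescoping sum up to the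
    constant [r 0]. *)
Lemma cvgn_bounded_variation (r : nat -> R) (M : R) :
  (forall n, \sum_(0 <= k < n) `|r k.+1 - r k| <= M) -> cvgn r.
Proof.
move=> rM; have : cvgn [normed series (fun k => r k.+1 - r k)].
  apply: nondecreasing_is_cvgn.
    apply/nondecreasing_seqP => n.
    by rewrite [leRHS]/series/= big_nat_recr//= lerDl.
  by exists M => _ [n _ <-]; exact: rM.
move=> /normed_cvg /cvg_ex[l hl]; apply/cvg_ex; exists (l + r 0%N).
rewrite [X in X @ _](_ : r = (fun n => series (fun k => r k.+1 - r k) n + r 0%N)).
  by apply: cvgD => //; exact: cvg_cst.
by apply/funext => n; rewrite /series/= telescope_sumr// subrK.
Qed.

Lemma Lnorm2_le_sqr (f : R -> R) (C : R) :
  measurable_fun [set: measurableTypeR R] (f : measurableTypeR R -> R) ->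
  0 <= C -> ('N[mu]_2%:E[EFin \o f] <= C%:E)%E ->
  (\int[mu]_x (f x ^+ 2)%:E <= (C ^+ 2)%:E)%E.
Proof.
move=> mf C0 fC.
rewrite (_ : (\int[mu]_x (f x ^+ 2)%:E)%E = ('N[mu]_2%:E[EFin \o f] `^ 2)%E); last first.
  rewrite powR_Lnorm//; apply: eq_integral => x _.
  by rewrite /= powR_mulrn// real_normK// num_real.
apply: (@le_trans _ _ (C%:E `^ 2)%E); last by rewrite poweR_EFin powR_mulrn.
apply: gt0_ler_poweR => //; rewrite in_itv/= leey ?andbT ?lee_fin//.
exact: Lnorm_ge0.
Qed.

Lemma Lnorm2_sum_le (d : nat -> R -> R) (c : nat -> R) n :
  (forall k, measurable_fun [set: measurableTypeR R] (d k : measurableTypeR R -> R)) ->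
  (forall k, ('N[mu]_2%:E[EFin \o d k] <= (c k)%:E)%E) ->
  ('N[mu]_2%:E[EFin \o (fun x => \sum_(0 <= k < n) d k x)%R] <=
     (\sum_(0 <= k < n) c k)%:E)%E.
Proof.
move=> md dc; elim: n => [|n IH].
  rewrite (_ : _ \o _ = cst 0%E); last by apply/funext => x; rewrite /= big_geq.
  by rewrite Lnorm0 ?big_geq// eqe pnatr_eq0.
rewrite (_ : EFin \o _ =
    EFin \o ((fun x => \sum_(0 <= k < n) d k x) \+ d n)%R); last first.
  by apply/funext => x; rewrite /= big_nat_recr.
rewrite big_nat_recr//= EFinD; apply: (le_trans _ (leeD IH (dc n))).
apply: eminkowski; rewrite ?lee_fin ?lerDl//.
exact: (@measurable_sum _ (measurableTypeR R)).
Qed.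

Lemma limn_einf_le (u : nat -> \bar R) (c : \bar R) n :
  (forall m, (n <= m)%N -> (u m <= c)%E) -> (limn_einf u <= c)%E.
Proof.
move=> uc; rewrite limn_einf_lim; apply: lime_le; first exact: is_cvg_einfs.
apply: nearW => k; apply: (@le_trans _ _ (u (maxn k n))).
  by apply: ereal_inf_lbound; exists (maxn k n) => //=; exact: leq_maxl.
by apply: uc; exact: leq_maxr.
Qed.

Section FastCauchy.
Variables (H : nat -> L2 R) (C : R).
Hypothesis HC : forall n, \sum_(0 <= k < n) L2norm (H k.+1 - H k) <= C.

Let d k x := normc ((H k.+1 - H k : L2 R) x).

Let md k : measurable_fun [set: measurableTypeR R] (d k : measurableTypeR R -> R).
Proof. by apply: normc_measurable; exact: L2_cmeasurable. Qed.

Let d_ge0 k x : 0 <= d k x. Proof. exact: normc_ge0. Qed.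

Let D n x := \sum_(0 <= k < n) d k x.

Let mD n : measurable_fun [set: measurableTypeR R] (D n : measurableTypeR R -> R).
Proof. exact: (@measurable_sum _ (measurableTypeR R)). Qed.

Let D_ge0 n x : 0 <= D n x. Proof. exact: sumr_ge0. Qed.

Let C_ge0 : 0 <= C. Proof. by apply: le_trans (HC 0); rewrite big_geq. Qed.

(** Minkowski's inequality bounds the norm of every [D n] by [C]. The squares increase with [n], so
    monotone convergence bounds the integral of their limit by [C ^+ 2], and an integrable function
    is finite almost everywhere. *)
Lemma fast_cauchy_bounded : {ae mu, forall x, exists M, forall n, D n x <= M}.
Proof.
have ND n : ('N[mu]_2%:E[EFin \o D n] <= C%:E)%E.
  apply: le_trans (_ : (\sum_(0 <= k < n) L2norm (H k.+1 - H k))%:E <= _)%E; last first.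
    by rewrite lee_fin.
  by apply: Lnorm2_sum_le => // k; rewrite /L2norm L2norm_funE//; exact: L2reprP.
pose g n x := ((D n x) ^+ 2)%:E.
have nd x : nondecreasing_seq (g ^~ x).
  apply/nondecreasing_seqP => n; rewrite lee_fin ler_sqr ?nnegrE//.
  by rewrite [leRHS]/D big_nat_recr//= lerDl.
have mg n : measurable_fun [set: measurableTypeR R] (g n : measurableTypeR R -> \bar R).
  by apply/measurable_EFinP; exact: measurable_funX.
have g0 n x : (0 <= g n x)%E by rewrite lee_fin sqr_ge0.
pose f x := limn (g ^~ x).
have mf : measurable_fun [set: measurableTypeR R] (f : measurableTypeR R -> \bar R).
  apply: emeasurable_fun_cvg mg _ => x _.
  exact: ereal_nondecreasing_is_cvgn.
have f0 x : (0 <= f x)%E.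
  by apply: lime_ge; [exact: ereal_nondecreasing_is_cvgn|exact: nearW].
have fi : (\int[mu]_x f x <= (C ^+ 2)%:E)%E.
  rewrite monotone_convergence//.
  apply: lime_le.
    apply: ereal_nondecreasing_is_cvgn => m n mn.
    by apply: ge0_le_integral => // x _; exact: nd.
  by apply: nearW => n; exact: Lnorm2_le_sqr.
have : {ae mu, forall x, setT x -> f x \is a fin_num}.
  apply: integrable_ae => //; apply/integrableP; split=> //.
  under eq_integral do rewrite gee0_abs//.
  exact: le_lt_trans fi (ltry _).
(* For nonnegative y, a bound y on the square of [D n x] gives the bound y + 1 on [D n x]. *)
apply: filterS => x /(_ I) fx; exists (fine (f x) + 1) => n.
have h : (g n x <= f x)%E.
  apply: lime_ge; first exact: ereal_nondecreasing_is_cvgn.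
  by exists n => // m /= nm; exact: nd.
move: h; rewrite -[X in (_ <= X)%E]fineK// lee_fin => h.
have f1 : 0 <= fine (f x) by rewrite fine_ge0.
rewrite -ler_sqr ?nnegrE ?addr_ge0//; nra.
Qed.

Lemma fast_cauchy_cvg : {ae mu, forall x,
  cvgn (fun n => Re (H n x)) /\ cvgn (fun n => Im (H n x))}.
Proof.
have h : {ae mu, forall x, forall k, (H k.+1 - H k : L2 R) x = H k.+1 x - H k x}.
  apply: ae_foralln => k; apply: filterS2 (L2reprD (H k.+1) (- H k)) (L2reprZ (-1) (H k)).
  by move=> x e; rewrite scaleN1r mulN1r => e'; rewrite e e'.
apply: filterS2 fast_cauchy_bounded h => x [M DM] e; split.
- apply: (@cvgn_bounded_variation _ M) => n; apply: le_trans (DM n).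
  by apply: ler_sum => k _; rewrite /d e -cReN -cReD; exact: Re_le_normc.
- apply: (@cvgn_bounded_variation _ M) => n; apply: le_trans (DM n).
  by apply: ler_sum => k _; rewrite /d e -cImN -cImD; exact: Im_le_normc.
Qed.

(** An upper limit is measurable whether or not the sequence converges. On the null set where
    convergence fails, the value of [g] is immaterial. *)
Let l (p : R[i] -> R) x : R := fine (limn_esup (fun n => (p (H n x))%:E)).
Let g x : R[i] := Complex (l (@complex.Re _) x) (l (@complex.Im _) x).

Let mg : cmeasurable (g : measurableTypeR R -> R[i]).
Proof.
split.
- apply: (@measurableT_comp _ _ _ _ _ _ fine) => //.
  apply: measurable_fun_limn_esup => n; apply/measurable_EFinP.
  by case: (L2_cmeasurable (H n)).
- apply: (@measurableT_comp _ _ _ _ _ _ fine) => //.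
  apply: measurable_fun_limn_esup => n; apply/measurable_EFinP.
  by case: (L2_cmeasurable (H n)).
Qed.

Let g_cvg : {ae mu, forall x, (fun n => Re (H n x)) @ \oo --> Re (g x) /\
  (fun n => Im (H n x)) @ \oo --> Im (g x)}.
Proof.
have key (r : nat -> R) : cvgn r ->
    r @ \oo --> fine (limn_esup (fun n => (r n)%:E)).
  move=> /cvg_ex[a ra].
  have [_ ->] : (limn_einf (EFin \o r) = a%:E) * (limn_esup (EFin \o r) = a%:E).
    by apply: cvg_limn_einf_sup; apply: cvg_EFin => //; exact: nearW.
  exact: ra.
by apply: filterS fast_cauchy_cvg => x [cr ci]; split; exact: key.
Qed.

(** Fatou's lemma: the integrand is almost everywhere the limit in [m] of the squared modulus of
    [H m - H n], whose integral is at most [e ^+ 2] once [n <= m]. *)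
Lemma fast_cauchy_dist n e :  0 <= e ->
  (forall m, (n <= m)%N -> L2norm (H m - H n) <= e) ->
  (\int[mu]_x (normc (g x - H n x) ^+ 2)%:E <= (e ^+ 2)%:E)%E.
Proof.
move=> e0 He.
pose F m x := ((normc ((H m - H n : L2 R) x)) ^+ 2)%:E.
have mF m : measurable_fun [set: measurableTypeR R] (F m : measurableTypeR R -> \bar R).
  apply/measurable_EFinP; apply: measurable_funX; apply: normc_measurable.
  exact: L2_cmeasurable.
have F0 m x : (0 <= F m x)%E by rewrite lee_fin sqr_ge0.
have hF : (\int[mu]_x limn_einf (F ^~ x) <= (e ^+ 2)%:E)%E.
  apply: (le_trans (fatou _ _ _ _)) => //.
  apply: (@limn_einf_le _ _ n) => m nm.
  apply: Lnorm2_le_sqr => //.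
    by apply: normc_measurable; exact: L2_cmeasurable.
  by rewrite -L2norm_funE ?lee_fin; [exact: He|exact: L2reprP].
apply: le_trans hF; apply: ae_ge0_le_integral => //.
- by move=> x _; rewrite lee_fin sqr_ge0.
- apply/measurable_EFinP; apply: measurable_funX; apply: normc_measurable.
  apply: cmeasurableD => //; rewrite (_ : (fun x => - H n x) = (fun x => -1 * H n x)).
    by apply: cmeasurableZ; exact: L2_cmeasurable.
  by apply/funext => x; rewrite mulN1r.
- move=> x _; rewrite limn_einf_lim; apply: lime_ge; first exact: is_cvg_einfs.
  by apply: nearW => k; apply: le_ereal_inf_tmp => _ [m _ <-].
- rewrite /limn_einf; apply: measurableT_comp => //.
  by apply: measurable_fun_limn_esup => m; exact: measurableT_comp.
have h : {ae mu, forall x, forall m, (H m - H n : L2 R) x = H m x - H n x}.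
  apply: ae_foralln => k; apply: filterS2 (L2reprD (H k) (- H n)) (L2reprZ (-1) (H n)).
  by move=> x a; rewrite scaleN1r mulN1r => b; rewrite a b.
apply: filterS2 g_cvg h => x [cr ci] hx _.
suff : F ^~ x @ \oo --> (normc (g x - H n x) ^+ 2)%:E.
  by move=> /cvg_limn_einf_sup [-> _].
rewrite /F; under eq_fun do rewrite hx normc_sqr cReD cImD.
rewrite normc_sqr cReD cImD; apply: cvg_EFin; first exact: nearW.
rewrite /comp/=.
apply: cvgD; rewrite expr2; under eq_fun do rewrite expr2;
  by apply: cvgM; apply: cvgD => //; exact: cvg_cst.
Qed.

Lemma fast_cauchy_limit : exists G : L2 R, forall n e, 0 <= e ->
  (forall m, (n <= m)%N -> L2norm (H m - H n) <= e) -> L2norm (G - H n) <= e.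
Proof.
have mgH n : cmeasurable ((fun x => g x - H n x) : measurableTypeR R -> R[i]).
  apply: cmeasurableD => //; rewrite (_ : (fun x => - H n x) = (fun x => -1 * H n x)).
    by apply: cmeasurableZ; exact: L2_cmeasurable.
  by apply/funext => x; rewrite mulN1r.
(* The Fatou bound at [n = 0] with [e = C] makes [g - H 0] square integrable; adding [H 0] back
   gives [g]. *)
have sg : square_integrable g.
  have h0 : forall m, (0 <= m)%N -> L2norm (H m - H 0%N) <= C.
    move=> m _; apply: le_trans (HC m); rewrite -(telescope_sumr H (leq0n m)).
    exact: (@ler_norm_sum _ (RL2 R)).
  have hi : square_integrable (fun x => g x - H 0%N x).
    apply: square_integrableP => //; apply/integrableP; split.
      apply/measurable_EFinP; apply: measurable_funX.
      exact: normc_measurable (mgH 0%N).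
    under eq_integral do rewrite gee0_abs ?lee_fin ?sqr_ge0//.
    exact: le_lt_trans (fast_cauchy_dist C_ge0 h0) (ltry _).
  have p1 : (fun x => g x - H 0%N x) \in @sqint_pred R by apply/asboolP.
  have p2 : (H 0%N : R -> R[i]) \in @sqint_pred R by apply/asboolP/L2reprP.
  have /asboolP := rpredD p1 p2.
  by congr square_integrable; apply/funext => x; exact: (subrK (H 0%N x) (g x)).
have sgp : g \in @sqint_pred R by apply/asboolP.
exists (\pi_(L2 R) (SqFun sgp)) => n e e0 He.
rewrite -ler_sqr ?nnegrE ?L2norm_ge0//.
rewrite (L2norm_fun_sqr (L2reprP _)) -lee_fin /Rintegral fineK; last first.
  apply: integrable_fin_num => //; apply/integrableP; split.
    apply/measurable_EFinP; apply: measurable_funX.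
    by apply: normc_measurable; exact: L2_cmeasurable.
  under eq_integral do rewrite gee0_abs ?lee_fin ?sqr_ge0//.
  apply: (@le_lt_trans _ _ ((L2norm (\pi_(L2 R) (SqFun sgp) - H n)) ^+ 2)%:E); last exact: ltry.
  apply: Lnorm2_le_sqr; [|exact: L2norm_ge0|].
    by apply: normc_measurable; exact: L2_cmeasurable.
  by rewrite -L2norm_funE//; exact: L2reprP.
apply: le_trans (fast_cauchy_dist e0 He).
apply: ae_ge0_le_integral => //.
- by move=> x _; rewrite lee_fin sqr_ge0.
- apply/measurable_EFinP; apply: measurable_funX.
  by apply: normc_measurable; exact: L2_cmeasurable.
- by move=> x _; rewrite lee_fin sqr_ge0.
- apply/measurable_EFinP; apply: measurable_funX.
  exact: normc_measurable (mgH n).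
have h1 := L2reprD (\pi_(L2 R) (SqFun sgp)) (- H n).
have h2 := L2reprZ (-1) (H n); rewrite scaleN1r in h2.
have h3 := L2repr_pi (SqFun sgp).
apply: (filterS2 _ _ h1 (filterI h2 h3)) => x -> [-> ->] _.
by rewrite mulN1r.
Qed.

End FastCauchy.

(** This is the Riesz-Fischer argument: a subsequence with summable increments converges almost
    everywhere, its pointwise limit is also its limit in norm, and a Cauchy sequence follows its
    subsequence. *)
Lemma L2_complete (F : nat -> L2 R) :
  (forall e, 0 < e -> exists N, forall m n, (N <= m)%N -> (N <= n)%N ->
    L2norm (F m - F n) <= e) ->
  exists G : L2 R, forall e, 0 < e -> exists N, forall n, (N <= n)%N ->
    L2norm (F n - G) <= e.
Proof.
move=> hF.
have [N hN] : {N : nat -> nat | forall k m n, (N k <= m)%N -> (N k <= n)%N ->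
    L2norm (F m - F n) <= 2^-1 ^+ k}.
  have /choice[N hN] : forall k, exists N, forall m n, (N <= m)%N -> (N <= n)%N ->
      L2norm (F m - F n) <= 2^-1 ^+ k.
    by move=> k; apply: hF; rewrite exprn_gt0.
  by exists N.
(* The maximum puts [p k] beyond every [N j] with [j <= k], in whatever order the values of [N]
   come. *)
pose p k := \max_(j < k.+1) N j.
have Np j k : (j <= k)%N -> (N j <= p k)%N.
  by move=> jk; exact: (leq_bigmax (Ordinal (jk : (j < k.+1)%N))).
have hs n : \sum_(0 <= k < n) L2norm (F (p k.+1) - F (p k)) <= 2 :> R.
  apply: (@le_trans _ _ (\sum_(0 <= k < n) 2^-1 ^+ k)).
    by apply: ler_sum => k _; apply: hN; exact: Np.
  rewrite (_ : \sum_(0 <= k < n) _ = 2 - 2 * 2^-1 ^+ n); last first.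
    elim: n => [|n IH]; first by rewrite big_geq// expr0 mulr1 subrr.
    by rewrite big_nat_recr//= IH exprS; lra.
  by rewrite gerBl mulr_ge0// exprn_ge0.
have [G hG] := fast_cauchy_limit (H := F \o p) hs.
exists G => e e0.
(* The factor 2 collects two errors of size [2^-1 ^+ k]: from [F n] to [F (p k)], and from there to
   [G]. *)
have [k hk] : exists k, 2 * 2^-1 ^+ k <= e.
  have := @cvg_geometric R 2 2^-1; rewrite ger0_norm// => /(_ (ltac:(lra))).
  move=> /cvgrPdist_le/(_ e e0) [k _ /(_ k (leqnn k))].
  by rewrite /= sub0r normrN ger0_norm; [exists k|rewrite mulr_ge0// exprn_ge0].
exists (N k) => n kn.
rewrite -(subrK (F (p k)) (F n)) -addrA.
apply: (le_trans (L2normD _ _)); apply: le_trans hk.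
rewrite mulr_natl mulr2n lerD//; first by apply: hN => //; exact: Np.
rewrite L2normB; apply: hG; first by rewrite exprn_ge0.
by move=> m km; apply: hN; exact: Np.
Qed.

End Completeness.

(** * Adjoints and the family M *)

Section BoundedOperators.
Variable R : realType.
Implicit Types (F G H : L2 R) (A B S T : L2 R -> L2 R).

Lemma bounded_opD A : bounded_operator A -> forall F G, A (F + G) = A F + A G.
Proof. by move=> [lA _] F G; have := lA 1 F G; rewrite !scale1r. Qed.

Lemma bounded_op0 A : bounded_operator A -> A 0 = 0.
Proof. by move=> hA; apply: (addrI (A 0)); rewrite -(bounded_opD hA) !addr0. Qed.

Lemma bounded_opZ A : bounded_operator A -> forall a F, A (a *: F) = a *: A F.
Proof.
by move=> hA a F; case: (hA) => lA _; have := lA a F 0; rewrite !addr0 (bounded_op0 hA) addr0.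
Qed.

Lemma bounded_opB A : bounded_operator A -> forall F G, A (F - G) = A F - A G.
Proof. by move=> hA F G; rewrite (bounded_opD hA) -scaleN1r (bounded_opZ hA) scaleN1r. Qed.

Lemma bounded_op_sum A (I : Type) (r : seq I) (P : pred I) (f : I -> L2 R) :
  bounded_operator A -> A (\sum_(i <- r | P i) f i) = \sum_(i <- r | P i) A (f i).
Proof.
move=> hA; apply: (big_morph A) => [F G|]; [exact: bounded_opD|exact: bounded_op0].
Qed.

Lemma bounded_op_bound A : bounded_operator A ->
  exists2 M, 0 <= M & forall F, L2norm (A F) <= M * L2norm F.
Proof.
move=> [_ [M hM]]; exists `|M| => // F; apply: le_trans (hM F) _.
by apply: ler_wpM2r (ler_norm _); exact: L2norm_ge0.
Qed.

Lemma bounded_op_id : bounded_operator (@idfun (L2 R)).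
Proof. by split=> //; exists 1 => F; rewrite mul1r. Qed.

Lemma bounded_op_comp A B : bounded_operator A -> bounded_operator B ->
  bounded_operator (A \o B).
Proof.
move=> hA hB; split.
  move=> a F G /=; rewrite (bounded_opD hB) (bounded_opZ hB).
  by rewrite (bounded_opD hA) (bounded_opZ hA).
have [M M0 hM] := bounded_op_bound hA; have [N N0 hN] := bounded_op_bound hB.
exists (M * N) => F; apply: le_trans (hM _) _.
by rewrite -mulrA ler_wpM2l.
Qed.

Lemma bounded_op_axpy a A B : bounded_operator A -> bounded_operator B ->
  bounded_operator (fun F => A F + a *: B F).
Proof.
move=> hA hB; split.
  move=> b F G; rewrite (bounded_opD hA) (bounded_opD hB) (bounded_opZ hA) (bounded_opZ hB).
  rewrite !scalerDr !scalerA.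
  by rewrite (mulrC a) addrACA.
have [M M0 hM] := bounded_op_bound hA; have [N N0 hN] := bounded_op_bound hB.
exists (M + normc a * N) => F; apply: le_trans (L2normD _ _) _.
by rewrite mulrDl lerD// L2normZ -mulrA ler_wpM2l ?normc_ge0.
Qed.

(* The representing vector is the limit of a minimizing sequence of
   [|F|^2 - 2 Re (phi F)], which is Cauchy by the parallelogram law. *)
Lemma riesz (phi : L2 R -> R[i]) (M : R) :
  (forall F G, phi (F + G) = phi F + phi G) ->
  (forall a F, phi (a *: F) = a * phi F) ->
  (forall F, normc (phi F) <= M * L2norm F) ->
  exists G, forall F, phi F = L2inner F G.
Proof.
move=> phiD phiZ phiM.
pose J F := L2norm F ^+ 2 - 2 * Re (phi F).
(* Completing the square in |F|^2 - 2 M |F|. *)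
have Jlb F : - M ^+ 2 <= J F.
  have := le_trans (Re_le_normc _) (phiM F); rewrite ler_norml => /andP[_].
  rewrite /J; have := sqr_ge0 (L2norm F - M); nra.
have hlb : has_lbound (range J) by exists (- M ^+ 2) => _ [F _ <-].
pose m := inf (range J).
have mJ F : m <= J F by apply: ge_inf => //; exists F.
have [f hf] : {f : nat -> L2 R | forall n, J (f n) <= m + n.+1%:R^-1}.
  suff /choice[f hf] : forall n : nat, exists F, J F <= m + n.+1%:R^-1 by exists f.
  move=> n; have hi : has_inf (range J) by split=> //; exists (J 0), 0.
  have n0 : 0 < n.+1%:R^-1 :> R by rewrite invr_gt0.
  by have [_ [F _ <-] hF] := inf_adherent n0 hi; exists F; exact: ltW.
(* [J] is at least [m] at the midpoint of [F] and [G]; the parallelogram law turns this into a bound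
   on their distance. *)
have par F G : L2norm (F - G) ^+ 2 <= 2 * (J F - m) + 2 * (J G - m).
  have := mJ ((2^-1)%:C%C *: (F + G)).
  rewrite /J phiZ L2normZ exprMn L2norm_sqrB L2norm_sqrD phiD.
  rewrite normc_sqr /= cReM cReD /=; lra.
have small e : 0 < e -> exists N, forall n, (N <= n)%N -> n.+1%:R^-1 <= e :> R.
  move=> e0; have := @cvg_harmonic R => /cvgrPdist_le/(_ e e0) [N _ hN].
  exists N => n /hN /=; rewrite sub0r normrN ger0_norm//.
have [|G hG] := @L2_complete R f.
  move=> e e0; have [|N hN] := small (e ^+ 2 / 4); first by rewrite divr_gt0// exprn_gt0.
  exists N => p q Np Nq; rewrite -ler_sqr ?nnegrE ?L2norm_ge0 ?(ltW e0)//.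
  apply: (le_trans (par _ _)).
  move: (hf p) (hf q) (hN _ Np) (hN _ Nq).
  move: (J (f p)) (J (f q)) (p.+1%:R^-1) (q.+1%:R^-1) => a b c d. lra.
(* First variation: [J] is at least [m] at [f n + t H] for every real [t]. In the limit the
   polynomial [2 t a + t^2 h] is nonnegative for all [t], which forces its linear coefficient [a] to
   vanish. *)
have ReG H : Re (phi H) = Re (L2inner H G).
  set h := L2norm H ^+ 2; have h0 : 0 <= h by exact: sqr_ge0.
  pose a := Re (L2inner H G) - Re (phi H).
  have key t e : 0 < e -> 0 <= 2 * t * a + t ^+ 2 * h + e.
    move=> e0.
    have e1 : 0 < e / 2 by rewrite divr_gt0.
    have [N hN] := small _ e1.
    (* With [f n] this close to [G], replacing one by the other in the cross term costs at most e /
       2; the other e / 2 pays for [J (f n)] exceeding [m]. *)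
    have c0 : 0 < 4 * `|t| * L2norm H + 1.
      by rewrite ltr_pwDr// !mulr_ge0// L2norm_ge0.
    have [|N' hN'] := hG (e / (4 * `|t| * L2norm H + 1)); first by rewrite divr_gt0.
    pose n := maxn N N'.
    have := mJ (f n + t%:C%C *: H); have := hf n.
    have := hN n (leq_maxl _ _); have := hN' n (leq_maxr _ _).
    rewrite /J phiD phiZ L2norm_sqrD L2normZ exprMn normc_real real_normK ?num_real// L2innerZr -/h.
    rewrite ler_pdivlMr// => d1 d2 d3.
    have : t * (Re (L2inner (f n) H) - Re (L2inner H G)) <= e / 4.
      apply: le_trans (ler_norm _) _; rewrite normrM.
      rewrite (L2innerC G H) cReconj -cReN -cReD -L2innerBl.
      apply: le_trans (ler_wpM2l (normr_ge0 t) (Re_L2inner_le _ _)) _.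
      have := L2norm_ge0 (f n - G); move: d1; nra.
    move: d2 d3; rewrite conjc_real cReD !cRe_realM /a.
    move: (Re (L2inner (f n) H)) (Re (L2inner H G)) (Re (phi H)).
    move: (L2norm (f n) ^+ 2) (Re (phi (f n))) (n.+1%:R^-1) => x y z u v w.
    by clearbody h m; clear -x y z u v w e t h m; nra.
  have key0 t : 0 <= 2 * t * a + t ^+ 2 * h.
    by apply/ler_addgt0Pr => e /(key t).
  (* At this [t] the polynomial is negative unless [a = 0]. The denominator [h + 1] in place of [h]
     covers the case [H = 0] as well. *)
  have := key0 (- a / (h + 1)).
  have h1 : h + 1 != 0 by rewrite gt_eqF// ltr_wpDl.
  rewrite (_ : 2 * _ * _ + _ = - (a ^+ 2 * (h + 2) / (h + 1) ^+ 2)); last by field.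
  rewrite oppr_ge0 pmulr_lle0 ?invr_gt0 ?exprn_gt0 ?ltr_wpDl// pmulr_lle0 ?ltr_wpDl//.
  move=> a0; have /eqP : a ^+ 2 = 0 by apply/eqP; rewrite eq_le a0 sqr_ge0.
  by rewrite sqrf_eq0 subr_eq0 => /eqP.
(* The real parts agree at every vector; at ['i F] this says that the imaginary parts agree at
   [F]. *)
exists G => F; apply: complex_eqP => //.
have := ReG ('i%C *: F); rewrite phiZ L2innerZl !cReM /= !mul0r !mul1r !sub0r.
exact: oppr_inj.
Qed.

Lemma adjoint_exists A : bounded_operator A -> exists S, is_adjoint A S.
Proof.
move=> hA; have [M M0 hM] := bounded_op_bound hA.
have /choice[S hS] : forall G, exists H, forall F, L2inner (A F) G = L2inner F H.
  move=> G; apply: (@riesz (fun F => L2inner (A F) G) (M * L2norm G)).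
  - by move=> F H; rewrite (bounded_opD hA) L2innerDl.
  - by move=> a F; rewrite (bounded_opZ hA) L2innerZl.
  - move=> F; apply: le_trans (L2_cauchy_schwarz _ _) _.
    by rewrite mulrAC ler_wpM2r// L2norm_ge0.
exists S; split=> //; split.
  move=> a F G; apply: L2inner_inj => H.
  by rewrite -hS !L2innerDr !L2innerZr -!hS.
exists M => G.
(* Boundedness comes from |S G|^2 = <A (S G), G> <= M |S G| |G|, divided by |S G| when this is not
   zero. *)
have [->|n0] := eqVneq (L2norm (S G)) 0; first by rewrite mulr_ge0// L2norm_ge0.
have np : 0 < L2norm (S G) by rewrite lt0r n0 L2norm_ge0.
rewrite -(ler_pM2l np) -expr2 L2norm_sqr -hS.
apply: le_trans (ler_norm _) _; apply: le_trans (Re_L2inner_le _ _) _.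
by rewrite mulrA ler_wpM2r ?L2norm_ge0// mulrC.
Qed.

Lemma adjointP A : bounded_operator A -> is_adjoint A (adjoint A).
Proof. by move=> /adjoint_exists; exact: xgetPex. Qed.

Lemma adjoint_bounded A : bounded_operator A -> bounded_operator (adjoint A).
Proof. by move=> /adjointP[]. Qed.

Lemma adjointE A : bounded_operator A -> forall F G,
  L2inner (A F) G = L2inner F (adjoint A G).
Proof. by move=> /adjointP[_]. Qed.

Lemma adjointEr A : bounded_operator A -> forall F G,
  L2inner F (A G) = L2inner (adjoint A F) G.
Proof. by move=> hA F G; rewrite L2innerC (adjointE hA) -L2innerC. Qed.

Lemma adjoint_unique A S : bounded_operator A -> is_adjoint A S -> S = adjoint A.
Proof.
move=> hA [_ hS]; apply/funext => G; apply: L2inner_inj => F.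
by rewrite -hS (adjointE hA).
Qed.

Lemma adjoint_comp A B : bounded_operator A -> bounded_operator B ->
  adjoint (A \o B) = adjoint B \o adjoint A.
Proof.
move=> hA hB; symmetry; apply: adjoint_unique; first exact: bounded_op_comp.
split; first by apply: bounded_op_comp; exact: adjoint_bounded.
by move=> F G /=; rewrite (adjointE hA) (adjointE hB).
Qed.

(** Since [A] commutes with [T], it may be written on either side of [T], and [adjoint A] on either
    side of [adjoint T]. So [T] or its adjoint can always be brought to the outer end, and the
    remaining factor is absorbed into the bounded cofactor. *)
Lemma Mfamily_comp T A : bounded_operator T -> bounded_operator A ->
  T \o A = A \o T -> Mfamily T (T \o A) /\ (Mfamily (T \o A) `<=` Mfamily T).
Proof.
move=> hT hA TA; split.
  by split; left; [exists A|rewrite TA; exists A].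
move=> P [hr hl]; split.
- case: hr => -[B hB <-]; [left; exists (A \o B)|right] => //; first exact: bounded_op_comp.
  rewrite TA adjoint_comp//; exists (adjoint A \o B) => //.
  by apply: bounded_op_comp => //; exact: adjoint_bounded.
- case: hl => -[B hB <-]; [left|right].
    by rewrite TA; exists (B \o A) => //; exact: bounded_op_comp.
  rewrite adjoint_comp//; exists (B \o adjoint A) => //.
  by apply: bounded_op_comp => //; exact: adjoint_bounded.
Qed.

Lemma resolventP T l : regular_values T l -> is_resolvent T l (resolvent T l).
Proof. exact: xgetPex. Qed.

Lemma resolvent_bounded T l : regular_values T l -> bounded_operator (resolvent T l).
Proof. by move=> /resolventP[]. Qed.

(** [T F] equals [I - l T] applied to [T (S F)], and [S] undoes [I - l T]. *)
Lemma resolvent_comm T l : bounded_operator T -> regular_values T l ->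
  T \o resolvent T l = resolvent T l \o T.
Proof.
move=> hT /resolventP[hS h1 h2]; apply/funext => F /=.
set S := resolvent T l in hS h1 h2 *.
by rewrite -{2}(h1 F) (bounded_opB hT) (bounded_opZ hT) h2.
Qed.

Lemma fredholm_mercer T l K : bounded_operator T -> mercer_kernel T K ->
  regular_values T l -> exists K', mercer_kernel (fredholm_resolvent T l) K'.
Proof.
move=> hT [_ _ hM] hl.
have [m1 m2] := Mfamily_comp hT (resolvent_bounded hl) (resolvent_comm hT hl).
have [K' k1 k2] := hM _ m1; exists K'; split=> // A hA; apply: hM; exact: m2.
Qed.

End BoundedOperators.

(** * Averages over small balls *)

Section Bumps.
Variable R : realType.
Local Notation mu := (@lebesgue_measure R).

Definition bumpf (s r : R) (x : R) : R := (2 * r)^-1 * \1_(ball s r) x.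

Definition L2bump (s r : R) : L2 R := L2class (fun x => (bumpf s r x)%:C%C).

Lemma L2classP (h : R -> R[i]) : square_integrable h ->
  {ae mu, forall x, L2class h x = h x}.
Proof.
move=> sh; apply: filterS (L2repr_pi (insubd 0 h)) => x ->.
by rewrite -[sqfun_fun _]/(\val _) insubdK//; apply/asboolP.
Qed.

Lemma bumpf_ge0 s r x : 0 <= r -> 0 <= bumpf s r x.
Proof. by move=> r0; rewrite mulr_ge0// invr_ge0 mulr_ge0. Qed.

Lemma measurable_bumpf s r :
  measurable_fun [set: measurableTypeR R] (bumpf s r : measurableTypeR R -> R).
Proof.
apply: measurable_funM => //; apply: measurable_indic.
exact: measurable_ball.
Qed.

Lemma integrable_indic_ball (s r : R) :
  mu.-integrable setT (EFin \o (\1_(ball s r) : R -> R)).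
Proof. by rewrite ball_itv; exact: integrable_indic_itv. Qed.

Lemma integrable_bumpf s r : 0 < r -> mu.-integrable setT (EFin \o bumpf s r).
Proof.
move=> r0; rewrite /bumpf/= (_ : EFin \o _ =
  (fun x => ((2 * r)^-1)%:E * (\1_(ball s r) x)%:E)%E); last first.
  by apply/funext => x; rewrite /= EFinM.
by apply: integrableZl => //; exact: integrable_indic_ball.
Qed.

Lemma Rintegral_bumpf s r : 0 < r -> \int[mu]_x bumpf s r x = 1.
Proof.
move=> r0; rewrite /bumpf RintegralZl//; last exact: integrable_indic_ball.
rewrite /Rintegral integral_indic//; last exact: measurable_ball.
rewrite setIT [fine _](congr1 fine (lebesgue_measure_ball s (ltW r0)))/=.
by rewrite -[r *+ 2]mulr_natl mulVf// gt_eqF// mulr_gt0.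
Qed.

Lemma bump_square_integrable s r : 0 < r ->
  square_integrable (fun x => (bumpf s r x)%:C%C).
Proof.
move=> r0; apply: square_integrableP.
  by split=> //; exact: measurable_bumpf.
rewrite (_ : (fun x => _) = (fun x => ((2 * r)^-1)%:E * (bumpf s r x)%:E)%E).
  by apply: integrableZl => //; exact: integrable_bumpf.
apply/funext => x; rewrite normc_real real_normK ?num_real// -EFinM /bumpf.
by rewrite indicE; case: (_ \in _); rewrite ?mulr1 ?mulr0 ?expr0n.
Qed.

Lemma bumpE s r : 0 < r ->
  {ae mu, forall x, L2bump s r x = (bumpf s r x)%:C%C}.
Proof. by move=> r0; apply: L2classP; exact: bump_square_integrable. Qed.

(** As [bumpf] has total mass 1, [c] can be put under the integral; there the difference is at most
    [e] on the ball, and the weight vanishes outside it. *)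
Lemma average_close (f : R -> R) (s r c e : R) : 0 < r -> 0 <= e ->
  mu.-integrable setT (EFin \o (fun x => f x * bumpf s r x)) ->
  {ae mu, forall x, ball s r x -> `|f x - c| <= e} ->
  `|\int[mu]_x (f x * bumpf s r x) - c| <= e.
Proof.
move=> r0 e0 fi fc; have bi := integrable_bumpf s r0.
have ci : mu.-integrable setT (EFin \o (fun x => c * bumpf s r x)).
  by rewrite /comp; under eq_fun do rewrite EFinM; exact: integrableZl.
have -> : \int[mu]_x (f x * bumpf s r x) - c =
    \int[mu]_x (f x * bumpf s r x - c * bumpf s r x).
  by rewrite RintegralB// RintegralZl// Rintegral_bumpf// mulr1.
have di : mu.-integrable setT (EFin \o (fun x => f x * bumpf s r x - c * bumpf s r x)).
  by rewrite /comp; under eq_fun do rewrite EFinB; exact: integrableB.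
have /integrableP di' := di; have [md _] := di'.
rewrite -lee_fin EFin_normr_Rintegral//.
apply: (le_trans (le_abse_integral _ _ _)) => //.
apply: (@le_trans _ _ (\int[mu]_x (e * bumpf s r x)%:E)%E); last first.
  under eq_integral do rewrite EFinM; rewrite integralZl//.
  have := Rintegral_bumpf s r0; rewrite /Rintegral => h.
  by rewrite -[X in (_ * X <= _)%E]fineK ?integrable_fin_num// h mule1.
apply: ae_ge0_le_integral => //.
- exact: measurableT_comp.
- by move=> x _; rewrite lee_fin mulr_ge0// bumpf_ge0// ltW.
- by apply/measurable_EFinP; apply: measurable_funM => //; exact: measurable_bumpf.
apply: filterS fc => x fx _; rewrite lee_fin -mulrBl normrM.
rewrite (ger0_norm (bumpf_ge0 _ _ (ltW r0))).
have [xs|xs] := pselect (ball s r x).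
  by apply: ler_wpM2r; [exact: bumpf_ge0 (ltW r0)|exact: fx].
by rewrite /bumpf indicE memNset// !mulr0.
Qed.

Lemma bump_integrable (f : R -> R) s r : 0 < r -> f \in Lfun mu 2%:E ->
  mu.-integrable setT (EFin \o (fun x => f x * bumpf s r x)).
Proof.
move=> r0 hf; apply/Lfun1_integrable; apply: Lfun2_mul_Lfun1 => //.
by case: (square_integrable_ReIm (bump_square_integrable s r0)).
Qed.

Lemma L2inner_bump (F : L2 R) s r : 0 < r -> L2inner F (L2bump s r) =
  Complex (\int[mu]_x (Re (F x) * bumpf s r x)) (\int[mu]_x (Im (F x) * bumpf s r x)).
Proof.
move=> r0; rewrite /L2inner.
rewrite (@ae_eq_cintegral _ _ (fun x => F x * (bumpf s r x)%:C%C)).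
- congr Complex; apply: eq_Rintegral => x _.
    by rewrite cReM /= mulr0 subr0.
  by rewrite cImM /= mulr0 add0r.
- exact: L2_cmeasurable_mul.
- apply: cmeasurableM; first exact: L2_cmeasurable.
  by split=> //; exact: measurable_bumpf.
- by apply: filterS (bumpE s r0) => x ->; rewrite conjc_real.
Qed.

(** On a compact set, which has finite measure, |f| is dominated by the integrable function 1 +
    f^2. *)
Lemma Lfun2_locally_integrable (f : R -> R) : f \in Lfun mu 2%:E ->
  locally_integrable setT f.
Proof.
move=> hf; have fi := Lfun2_integrable_sqr hf.
have mf : measurable_fun [set: measurableTypeR R] (f : measurableTypeR R -> R).
  by move: hf; rewrite inE => /andP[/[!inE]].
split=> //; first exact: openT.
move=> K _ cK; have mK := compact_measurable cK.
have muK : (mu K < +oo)%E by exact: compact_finite_measure.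
apply: (@le_lt_trans _ _ (\int[mu]_(x in K) (1%:E + (f x ^+ 2)%:E))%E).
  apply: ge0_le_integral => //=.
  - by apply/measurable_EFinP; apply: measurableT_comp => //; exact: measurable_funTS.
  - rewrite /= ; under eq_fun do rewrite -EFinD; apply/measurable_EFinP; apply: measurable_funTS.
    by apply: measurable_funD => //; exact: measurable_funX.
  - move=> x _; rewrite -EFinD lee_fin -(real_normK (num_real (f x))).
    by have := sqr_ge0 (`|f x| - 1); have := normr_ge0 (f x); nra.
have fK : mu.-integrable K (fun x => (f x ^+ 2)%:E).
  by apply: integrableS fi.
rewrite ge0_integralD//; last 2 first.
  by move=> x _; rewrite lee_fin sqr_ge0.
  by apply/measurable_EFinP; apply: measurable_funTS; exact: measurable_funX.
rewrite integral_cst// mul1e lte_add_pinfty//.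
have /integrableP fK' := fK; have [_] := fK'.
by congr (_ < _)%E; apply: eq_integral => x _; rewrite /= ger0_norm ?sqr_ge0//.
Qed.

Lemma average_davg (f : R -> R) (s r : R) : 0 < r ->
  measurable_fun [set: measurableTypeR R] (f : measurableTypeR R -> R) ->
  mu.-integrable setT (EFin \o (fun x => f x * bumpf s r x)) ->
  ((`|\int[mu]_x (f x * bumpf s r x) - f s|)%:E <= davg f s r)%E.
Proof.
move=> r0 mf fi; have bi := integrable_bumpf s r0; set c := f s.
have ci : mu.-integrable setT (EFin \o (fun x => c * bumpf s r x)).
  by rewrite /comp; under eq_fun do rewrite EFinM; exact: integrableZl.
have -> : \int[mu]_x (f x * bumpf s r x) - c =
    \int[mu]_x (f x * bumpf s r x - c * bumpf s r x).
  by rewrite RintegralB// RintegralZl// Rintegral_bumpf// mulr1.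
have di : mu.-integrable setT (EFin \o (fun x => f x * bumpf s r x - c * bumpf s r x)).
  by rewrite /comp; under eq_fun do rewrite EFinB; exact: integrableB.
have /integrableP di' := di; have [md _] := di'.
rewrite EFin_normr_Rintegral//.
apply: (le_trans (le_abse_integral _ _ _)) => //.
have mfc : measurable_fun [set: measurableTypeR R]
    ((fun x => `|f x - c|) : measurableTypeR R -> R).
  by apply: measurableT_comp => //; exact: measurable_funB.
have -> : davg f s r = (\int[mu]_x (`|f x - c| * bumpf s r x)%:E)%E.
  rewrite /davg /iavg lebesgue_measure_ball ?ltW// inver mulrn_eq0/= gt_eqF//.
  transitivity (((r *+ 2)^-1)%:E * \int[mu]_x (`|f x - c| * \1_(ball s r) x)%:E)%E.
    congr (_ * _)%E; rewrite integral_mkcond epatch_indic.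
    by apply: eq_integral => x _; rewrite /= EFinM.
  rewrite -ge0_integralZl//.
  - by apply: eq_integral => x _; rewrite -EFinM /bumpf mulrCA mulr_natl.
  - apply/measurable_EFinP; apply: measurable_funM => //; apply: measurable_indic.
    exact: measurable_ball.
  - by rewrite lee_fin invr_ge0 mulrn_wge0// ltW.
apply: ge0_le_integral => //.
- exact: measurableT_comp.
- by apply/measurable_EFinP; apply: measurable_funM => //; exact: measurable_bumpf.
- move=> x _; rewrite lee_fin -mulrBl normrM.
  by rewrite (ger0_norm (bumpf_ge0 _ _ (ltW r0))).
Qed.

(** This is Lebesgue differentiation for the real and the imaginary part. The radii are taken along
    1/(n+1) because completeness, which later provides the limits of the bumps' images, is available
    for sequences. *)
Lemma L2_lebesgue_points (F : L2 R) : {ae mu, forall s, forall e, 0 < e ->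
  exists N, forall n, (N <= n)%N ->
   `|Re (L2inner F (L2bump s n.+1%:R^-1)) - Re (F s)| <= e /\
   `|Im (L2inner F (L2bump s n.+1%:R^-1)) - Im (F s)| <= e}.
Proof.
have [hr hi] := square_integrable_ReIm (L2reprP F).
have key f : f \in Lfun mu 2%:E -> {ae mu, forall s, forall e, 0 < e ->
    exists N, forall n, (N <= n)%N ->
    `|\int[mu]_x (f x * bumpf s n.+1%:R^-1 x) - f s| <= e}.
  move=> hf; have := lebesgue_differentiation (Lfun2_locally_integrable hf).
  apply: filterS => s hs e e0.
  have mf : measurable_fun [set: measurableTypeR R] (f : measurableTypeR R -> R).
    by move: hf; rewrite inE => /andP[/[!inE]].
  have h : (fun n : nat => davg f s n.+1%:R^-1) @ \oo --> 0%E.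
    apply: (cvg_comp _ _ _ hs) => A [d /= d0 hA].
    have [N _ hN] := (cvgrPdist_lt _ _).1 (@cvg_harmonic R) d d0.
    by exists N => // n Nn; apply: hA; [exact: hN|rewrite /= invr_gt0].
  have [[N1 _ h1] /cvgrPdist_le/(_ e e0) [N2 _ h2]] := (fine_cvgP _ _).1 h.
  exists (maxn N1 N2) => n; rewrite geq_max => /andP[/h1/= n1 /h2/=].
  rewrite sub0r normrN => n2.
  rewrite -lee_fin; apply: le_trans (average_davg _ mf (bump_integrable _ _ hf)) _;
    rewrite ?invr_gt0//.
  by rewrite -(fineK n1) lee_fin (le_trans (ler_norm _)).
apply: filterS2 (key _ hr) (key _ hi) => s h1 h2 e e0.
have [N1 H1] := h1 e e0; have [N2 H2] := h2 e e0.
exists (maxn N1 N2) => n; rewrite geq_max => /andP[n1 n2].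
rewrite L2inner_bump//; split; [exact: H1|exact: H2].
Qed.

End Bumps.

Section ComplexContinuity.
Variable R : realType.

Lemma nearby_norm (V : normedModType R) (z : V) (e : R) : 0 < e ->
  \forall w \near z, `|z - w| <= e.
Proof. by move=> e0; have /cvgrPdist_le := @cvg_id V (nbhs z); exact. Qed.

Lemma bounded_additive_continuous (V W : normedModType R) (f : V -> W) (M : R) :
  (forall x y, f (x - y) = f x - f y) -> (forall x, `|f x| <= M * `|x|) ->
  continuous f.
Proof.
move=> fB fM z; apply/cvgrPdist_le => e e0.
have M0 : 0 < `|M| + 1 by rewrite ltr_wpDl.
near=> w; rewrite -fB; apply: le_trans (fM _) _.
have : `|z - w| <= e / (`|M| + 1).
  by near: w; apply: nearby_norm; rewrite divr_gt0.
rewrite ler_pdivlMr//; have := normr_ge0 (z - w); have := ler_norm M; nra.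
Unshelve. all: by end_near. Qed.

Lemma cRe_continuous : continuous (fun z : Rcomplex R => Re z : R^o).
Proof.
apply: (@bounded_additive_continuous _ _ _ 1) => [x y|x]; first by rewrite cReD cReN.
by rewrite mul1r; exact: Re_le_normc.
Qed.

Lemma cIm_continuous : continuous (fun z : Rcomplex R => Im z : R^o).
Proof.
apply: (@bounded_additive_continuous _ _ _ 1) => [x y|x]; first by rewrite cImD cImN.
by rewrite mul1r; exact: Im_le_normc.
Qed.

Lemma continuous_cmeasurable (f : R -> Rcomplex R) : continuous f ->
  cmeasurable (f : measurableTypeR R -> R[i]).
Proof.
move=> cf; split; apply: continuous_measurable_fun => x.
- exact: (continuous_comp (cf x) (@cRe_continuous _)).
- exact: (continuous_comp (cf x) (@cIm_continuous _)).
Qed.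

Lemma continuous_sectionl (K : R -> R -> Rcomplex R) s :
  continuous (fun p : R * R => K p.1 p.2) -> continuous (K s).
Proof.
move=> cK t; have h : (s, u) @[u --> t] --> (s, t).
  apply: (@cvg_pair _ _ _ (nbhs t) (nbhs s) (nbhs t) _ _ _ (fun=> s) id).
    exact: cvg_cst.
  exact: cvg_id.
exact: (continuous_comp h (cK (s, t))).
Qed.

End ComplexContinuity.

(** * Point evaluations as inner products with a curve *)

Section FeatureMap.
Variable R : realType.
Local Notation mu := (@lebesgue_measure R).

(** Two averages in turn: for almost every t' near t, the function [P (L2bump s r)] takes at t' the
    average of [K t'] near s, and the bump at t averages these values. The first bump thus acts on
    the second variable of [K], whence [K t s]. *)
Lemma kernel_bump_close (P : L2 R -> L2 R) (K : R -> R -> Rcomplex R) (s t e : R) :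
  integral_operator P K ->
  continuous (fun p : R * R => K p.1 p.2) -> 0 < e ->
  exists2 d, 0 < d & forall r r', 0 < r -> r <= d -> 0 < r' -> r' <= d ->
    `|Re (L2inner (P (L2bump s r)) (L2bump t r')) - Re (K t s)| <= e.
Proof.
move=> [_ hP] cK e0.
have /nbhs_ballP[d d0 hd] : \forall p \near (t, s), `|K t s - K p.1 p.2| <= e.
  exact: (cvgrPdist_le _ _).1 (cK (t, s)) e e0.
exists d => // r r' r0 rd r'0 r'd.
rewrite L2inner_bump//; apply: average_close => //; first exact: ltW.
  by apply: bump_integrable => //; case: (square_integrable_ReIm (L2reprP (P (L2bump s r)))).
apply: filterS (hP (L2bump s r)) => t' [[iK _] ->] tt' /=.
have mKt' : cmeasurable (K t' : measurableTypeR R -> R[i]).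
  by apply: continuous_cmeasurable; exact: continuous_sectionl cK.
have mg : measurable_fun [set: measurableTypeR R]
    ((fun y => Re (K t' y) * bumpf s r y) : measurableTypeR R -> R).
  by case: mKt' => mr _; apply: measurable_funM => //; exact: measurable_bumpf.
have eqb : {ae mu, forall y, Re (K t' y * L2bump s r y) = Re (K t' y) * bumpf s r y}.
  by apply: filterS (bumpE s r0) => y ->; rewrite cReM /= mulr0 subr0.
rewrite (ae_eq_Rintegral _ mg eqb); last first.
  have /integrableP iK' := iK; have [mK _] := iK'.
  exact/measurable_EFinP.
apply: average_close => //; first exact: ltW.
  exact: ae_eq_integrable mg eqb iK.
apply: aeW => y sy; rewrite -cReN -cReD.
apply: le_trans (Re_le_normc _) _.
rewrite -[normc _]/(`|(K t' y - K t s : Rcomplex R)|) distrC.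
by apply: (hd (t', y)); split; [exact: le_ball tt'|exact: le_ball sy].
Qed.

Lemma eq_closeness (x y : R) : (forall e, 0 < e -> `|x - y| <= e) -> x = y.
Proof.
move=> h; apply/eqP; rewrite -subr_eq0 -normr_le0.
by apply/ler_addgt0Pr => e e0; rewrite add0r; exact: h.
Qed.

Lemma harmonic_small (e : R) : 0 < e ->
  exists N, forall n, (N <= n)%N -> n.+1%:R^-1 <= e.
Proof.
move=> e0; have := @cvg_harmonic R => /cvgrPdist_le/(_ e e0) [N _ hN].
by exists N => n /hN /=; rewrite sub0r normrN ger0_norm.
Qed.

(** The bounds d |G| and (|F| + d) d on the two halves of the difference add up to the claim, the
    summand 1 absorbing d^2 <= d. *)
Lemma L2inner_close (F G F' G' : L2 R) (d : R) :
  L2norm (F - F') <= d -> L2norm (G - G') <= d -> d <= 1 ->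
  normc (L2inner F G - L2inner F' G') <= d * (L2norm F + L2norm G + 1).
Proof.
move=> hF hG d1.
have F0 := L2norm_ge0 F; have G0 := L2norm_ge0 G; have d0 := le_trans (L2norm_ge0 _) hF.
have -> : L2inner F G - L2inner F' G' = L2inner (F - F') G + L2inner F' (G - G').
  by rewrite L2innerBl L2innerBr addrA subrK.
have F'n : L2norm F' <= L2norm F + d.
  rewrite -[F' in leLHS](subrK F) addrC; apply: le_trans (L2normD _ _) _.
  by rewrite lerD2l L2normB.
apply: le_trans (le_normcD _ _) _.
have h1 := le_trans (L2_cauchy_schwarz (F - F') G) (ler_wpM2r G0 hF).
have h2 := le_trans (L2_cauchy_schwarz F' (G - G')) (ler_wpM2l (L2norm_ge0 _) hG).
apply: le_trans (lerD h1 h2) _; have := L2norm_ge0 F'; nra.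
Qed.

(** In |x - y|^2 = <x,x> - 2 Re <x,y> + <y,y> the three occurrences of [c] cancel, and four errors
    of e^2 / 4 remain. *)
Lemma gram_close (x y : L2 R) (c e : R) : 0 <= e ->
  `|Re (L2inner x x) - c| <= e ^+ 2 / 4 ->
  `|Re (L2inner x y) - c| <= e ^+ 2 / 4 ->
  `|Re (L2inner y y) - c| <= e ^+ 2 / 4 -> L2norm (x - y) <= e.
Proof.
move=> e0 hxx hxy hyy; rewrite -ler_sqr ?nnegrE ?L2norm_ge0//.
rewrite L2norm_sqrB !L2norm_sqr.
move: hxx hxy hyy; rewrite !ler_norml.
by move=> /andP[_ h1] /andP[h2 _] /andP[_ h3]; clear -h1 h2 h3; lra.
Qed.

Lemma Re_L2inner_limit (x y : nat -> L2 R) (X Y : L2 R) (c : R) :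
  (forall e, 0 < e -> exists N, forall n, (N <= n)%N -> L2norm (x n - X) <= e) ->
  (forall e, 0 < e -> exists N, forall n, (N <= n)%N -> L2norm (y n - Y) <= e) ->
  (forall e, 0 < e -> exists N, forall n m, (N <= n)%N -> (N <= m)%N ->
    `|Re (L2inner (x n) (y m)) - c| <= e) ->
  Re (L2inner X Y) = c.
Proof.
move=> hx hy hxy; apply: eq_closeness => e e0.
pose C := L2norm X + L2norm Y + 1.
have c0 : 0 < C by rewrite ltr_wpDl// addr_ge0// L2norm_ge0.
pose d := Num.min 1 (e / 2 / C).
have d0 : 0 < d by rewrite lt_min ltr01 !divr_gt0.
have [|N1 h1] := hxy (e / 2); first by rewrite divr_gt0.
have [N2 h2] := hx d d0; have [N3 h3] := hy d d0.
pose n := maxn N1 (maxn N2 N3).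
have n1 : (N1 <= n)%N by rewrite leq_max leqnn.
have n2 : (N2 <= n)%N by rewrite !leq_max leqnn orbT.
have n3 : (N3 <= n)%N by rewrite !leq_max leqnn !orbT.
have h4 : normc (L2inner X Y - L2inner (x n) (y n)) <= e / 2.
  apply: (@le_trans _ _ (d * C)).
    apply: L2inner_close; [|..|by rewrite ge_min lexx].
      by rewrite L2normB h2.
    by rewrite L2normB h3.
  by rewrite -ler_pdivlMr// ge_min lexx orbT.
have h5 := le_trans (Re_le_normc _) h4; rewrite cReD cReN in h5.
have h6 := h1 _ _ n1 n1.
rewrite (splitr e) -(subrK (Re (L2inner (x n) (y n))) (Re (L2inner X Y))) -addrA.
exact: le_trans (ler_normD _ _) (lerD h5 h6).
Qed.

Lemma feature_map (V : L2 R -> L2 R) (K : R -> R -> Rcomplex R) :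
  bounded_operator V -> integral_operator (V \o adjoint V) K ->
  continuous (fun p : R * R => K p.1 p.2) ->
  exists v : R -> L2 R,
    (forall s t, Re (L2inner (v s) (v t)) = Re (K t s)) /\
    (forall F, {ae mu, forall s, V F s = L2inner F (v s)}).
Proof.
move=> hV hP cK.
pose b s n := adjoint V (L2bump s n.+1%:R^-1).
(* Moving [V] across the inner product turns the Gram matrix of the vectors [b s n] into
   [V \o adjoint V] tested on two bumps, which is close to the kernel. *)
have bK s t (e : R) : 0 < e -> exists N, forall n m, (N <= n)%N -> (N <= m)%N ->
    `|Re (L2inner (b s n) (b t m)) - Re (K t s)| <= e.
  move=> e0; have [d d0 hd] := kernel_bump_close s t hP cK e0.
  have [N hN] := harmonic_small d0; exists N => n m Nn Nm.
  by rewrite -(adjointE hV); apply: hd; rewrite ?invr_gt0 ?hN.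
have /choice[v hv] : forall s, exists G : L2 R, forall e, 0 < e -> exists N,
    forall n, (N <= n)%N -> L2norm (b s n - G) <= e.
  move=> s; apply: L2_complete => e e0.
  have [|N hN] := bK s s (e ^+ 2 / 4); first by rewrite divr_gt0// exprn_gt0.
  by exists N => n m Nn Nm; apply: (@gram_close _ _ (Re (K s s)) _ (ltW e0)); apply: hN.
exists v; split=> [s t|F].
  exact: (Re_L2inner_limit (hv s) (hv t) (bK s t)).
(* At a Lebesgue point of [V F] the products <V F, bump> tend to the value of [V F]; the same
   numbers are <F, b s n> and tend to <F, v s>. *)
apply: filterS (L2_lebesgue_points (V F)) => s hs.
have close (e : R) : 0 < e -> exists N, forall n, (N <= n)%N ->
    normc (L2inner (V F) (L2bump s n.+1%:R^-1) - L2inner F (v s)) <= e.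
  move=> e0; have c0 : 0 < L2norm F + 1 by rewrite ltr_wpDl// L2norm_ge0.
  have [|N hN] := hv s (e / (L2norm F + 1)); first by rewrite divr_gt0.
  exists N => n /hN h; rewrite (adjointE hV) -L2innerBr.
  apply: le_trans (L2_cauchy_schwarz _ _) _; move: h; rewrite ler_pdivlMr// -/(b s n).
  by have := L2norm_ge0 (b s n - v s); nra.
apply: complex_eqP; apply: eq_closeness => e e0.
- have [|N1 h1] := hs (e / 2); first by rewrite divr_gt0.
  have [|N2 h2] := close (e / 2); first by rewrite divr_gt0.
  have [] := h1 (maxn N1 N2) (leq_maxl _ _); have := h2 (maxn N1 N2) (leq_maxr _ _).
  move=> /(le_trans (Re_le_normc _)); rewrite cReD cReN => a1 a2 _.
  move: a1 a2; rewrite !ler_norml => /andP[a1 a2] /andP[a3 a4].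
  by apply/andP; split; clear -a1 a2 a3 a4; lra.
- have [|N1 h1] := hs (e / 2); first by rewrite divr_gt0.
  have [|N2 h2] := close (e / 2); first by rewrite divr_gt0.
  have [] := h1 (maxn N1 N2) (leq_maxl _ _); have := h2 (maxn N1 N2) (leq_maxr _ _).
  move=> /(le_trans (Im_le_normc _)); rewrite cImD cImN => a1 _ a2.
  move: a1 a2; rewrite !ler_norml => /andP[a1 a2] /andP[a3 a4].
  by apply/andP; split; clear -a1 a2 a3 a4; lra.
Qed.

End FeatureMap.

(** * Smooth curves with a given Gram matrix *)

Section Derivatives.
Variables (R : realType) (V : normedModType R).

(** [derive1] is a [lim], whose value is informative only when the limit exists, so value and
    existence are characterized together. *)
Lemma derive1P (f : R -> V) (s : R) (G : V) :
  (derivable f s 1 /\ derive1 f s = G) <->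
  (forall e : R, 0 < e -> exists2 d : R, 0 < d & forall h, h != 0 -> `|h| <= d ->
    `|h^-1 *: (f (s + h) - f s) - G| <= e).
Proof.
have E : (derivable f s 1 /\ derive1 f s = G) <->
    h^-1 *: (f (h + s) - f s) @[h --> 0^'] --> G.
  rewrite /derivable /derive1; under eq_fun do rewrite /GRing.scale/= mulr1.
  split=> [[h <-]//|h]; split; first by apply/cvg_ex; exists G.
  exact: cvg_lim h.
rewrite E; split=> [/cvgrPdist_le h e e0|h].
  have [d /= d0 hd] := h e e0; exists (d / 2); first by rewrite divr_gt0.
  move=> k k0 kd; rewrite distrC addrC [s + k]addrC.
  rewrite addrC; apply: hd => //=; rewrite sub0r normrN; apply: le_lt_trans kd _.
  by rewrite ltr_pdivrMr// ltr_pMr// ltr1n.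
apply/cvgrPdist_le => e e0; have [d d0 hd] := h e e0.
exists d => //= k; rewrite /= sub0r normrN => kd k0.
by rewrite distrC [k + s]addrC; apply: hd => //; exact: ltW.
Qed.

End Derivatives.

Section BoundedLinearImages.
Variables (R : realType) (V W : normedModType R).
Variables (L : V -> W) (M : R).
Hypothesis LB : forall x y, L (x - y) = L x - L y.
Hypothesis LZ : forall (a : R) x, L (a *: x) = a *: L x.
Hypothesis LM : forall x, `|L x| <= M * `|x|.

(** Homogeneity is over the reals, so that the conjugate-linear map [x -> L2inner F x] qualifies
    along with [Re], bounded operators and [x -> L2inner x F]. *)
Lemma derive1_bounded_linear (f : R -> V) s : derivable f s 1 ->
  derivable (fun t => L (f t)) s 1 /\
  derive1 (fun t => L (f t)) s = L (derive1 f s).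
Proof.
move=> df; apply/derive1P => e e0.
have M0 : 0 < `|M| + 1 by rewrite ltr_wpDl.
have /(derive1P _ _ _) /(_ (e / (`|M| + 1))) [|d d0 hd] :
  derivable f s 1 /\ derive1 f s = derive1 f s by [].
  by rewrite divr_gt0.
exists d => // h h0 hld; have := hd h h0 hld.
rewrite -LB -LZ -LB ler_pdivlMr// => hh; apply: le_trans (LM _) _.
set x := _ - _ in hh *; have := ler_norm M; have := normr_ge0 x; nra.
Qed.

Lemma derive1n_bounded_linear (f : R -> V) i : derivatives_exist f ->
  derive1n i (fun t => L (f t)) = (fun t => L (derive1n i f t)).
Proof.
move=> df; elim: i => // i IH; rewrite derive1nS IH.
by apply/funext => s; case: (derive1_bounded_linear (df i s)).
Qed.

Lemma derivatives_exist_bounded_linear (f : R -> V) :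
  derivatives_exist f -> derivatives_exist (fun t => L (f t)).
Proof.
move=> df i s; rewrite derive1n_bounded_linear//.
by case: (derive1_bounded_linear (df i s)).
Qed.

Lemma C0_bounded_linear (X : topologicalType) (f : X -> V) :
  C0 f -> C0 (fun x => L (f x)).
Proof.
move=> [cf f0]; split.
  move=> x; apply: (continuous_comp (cf x)).
  exact: (bounded_additive_continuous LB LM).
have M0 : 0 < `|M| + 1 by rewrite ltr_wpDl.
move=> e e0; have [|K cK hK] := f0 (e / (`|M| + 1)); first by rewrite divr_gt0.
exists K => // x /hK; rewrite ltr_pdivlMr// => h; apply: le_lt_trans (LM _) _.
have := ler_norm M; have := normr_ge0 (f x); nra.
Qed.

Lemma smooth_C0_bounded_linear (f : R -> V) :
  smooth_C0 f -> smooth_C0 (fun x => L (f x)).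
Proof.
move=> [df f0]; split; first exact: derivatives_exist_bounded_linear.
by move=> i; rewrite derive1n_bounded_linear//; exact: C0_bounded_linear.
Qed.

End BoundedLinearImages.

Section MixedDifferences.
Variable R : realType.

Lemma mean_value (g : R -> R^o) (x h : R) : (forall y, derivable g y 1) ->
  exists2 c, `|c - x| <= `|h| & g (x + h) - g x = h * derive1 g c.
Proof.
move=> dg.
have dg' (y : R) : is_derive (y : R^o) (1 : R^o) g (derive1 g y).
  by rewrite derive1E; apply: DeriveDef => //.
have cg : continuous g.
  by move=> y; apply: differentiable_continuous; apply/derivable1_diffP.
have [h0|h0] := leP 0 h.
  have xh : x <= x + h by rewrite lerDl.
  have [c] := MVT_segment xh (fun y _ => dg' y) (continuous_subspaceT cg).
  rewrite in_itv/= => /andP[xc cx] e; exists c.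
    by rewrite !ger0_norm// ?subr_ge0// lerBlDl.
  by rewrite e addrAC subrr add0r mulrC.
have xh : x + h <= x by rewrite gerDl ltW.
have [c] := MVT_segment xh (fun y _ => dg' y) (continuous_subspaceT cg).
rewrite in_itv/= => /andP[xc cx] e; exists c.
  by rewrite distrC (ltr0_norm h0) ger0_norm ?subr_ge0//; clear -xc; lra.
by rewrite -opprB e; ring.
Qed.

(** The mean value theorem is applied twice: in the first variable to [f x (y + k) - f x y], then in
    the second to the derivative so obtained. *)
Lemma mixed_mean_value (f : R -> R -> R^o) (x y h k : R) :
  (forall a b, derivable (f ^~ b) a 1) ->
  (forall a b, derivable (fun b => derive1 (f ^~ b) a : R^o) b 1) ->
  exists a b, [/\ `|a - x| <= `|h|, `|b - y| <= `|k| &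
    f (x + h) (y + k) - f (x + h) y - (f x (y + k) - f x y) =
    h * (k * derive1 (fun b => derive1 (f ^~ b) a : R^o) b)].
Proof.
move=> d1 d2.
have db a : derivable (fun x => f x (y + k) - f x y : R^o) a 1.
  by apply: derivableB; exact: d1.
have [a ha ea] := @mean_value (fun x => f x (y + k) - f x y) x h db.
have [b hb eb] := @mean_value (fun b => derive1 (f ^~ b) a) y k (d2 a).
exists a, b; split=> //; rewrite -eb.
rewrite (_ : derive1 (f ^~ (y + k)) a - derive1 (f ^~ y) a =
  derive1 (fun x => f x (y + k) - f x y : R^o) a).
  by rewrite -ea opprB addrACA [RHS]addrAC; ring.
by rewrite !derive1E deriveB//; exact: d1.
Qed.

End MixedDifferences.

Section GramDerivative.
Variable R : realType.

(** The inner product of two difference quotients of [v] is a mixed second difference of [f] divided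
    by [h k], hence a value of the mixed derivative [Psi] at a nearby point. By continuity of [Psi]
    and [gram_close] the quotients are Cauchy, and their limits have Gram matrix [Psi]. *)
Lemma gram_derivable (v : R -> L2 R) (f : R -> R -> R^o) :
  (forall s t, Re (L2inner (v s) (v t)) = f s t) ->
  (forall a b, derivable (f ^~ b) a 1) ->
  (forall a b, derivable (fun b => derive1 (f ^~ b) a : R^o) b 1) ->
  continuous (fun p : R * R => derive1 (fun b => derive1 (f ^~ b) p.1 : R^o) p.2 : R^o) ->
  (forall s, derivable (v : R -> RL2 R) s 1) /\
  (forall s t, Re (L2inner (derive1 (v : R -> RL2 R) s) (derive1 (v : R -> RL2 R) t)) =
     derive1 (fun b => derive1 (f ^~ b) s : R^o) t).
Proof.
move=> vf d1 d2; set Psi := fun p : R * R => _ => cPsi.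
pose q s h : L2 R := (h^-1)%:C%C *: (v (s + h) - v s).
have qE s t h k : h != 0 -> k != 0 -> exists a b, [/\ `|a - s| <= `|h|, `|b - t| <= `|k| &
    Re (L2inner (q s h) (q t k)) = Psi (a, b)].
  move=> h0 k0; have [a [b [ha hb e]]] := mixed_mean_value s t h k d1 d2.
  exists a, b; split=> //; rewrite /q L2innerZl L2innerZr conjc_real !cRe_realM.
  rewrite L2innerBl !L2innerBr !(cReD, cReN) !vf.
  transitivity (h^-1 * (k^-1 * (f (s + h) (t + k) - f (s + h) t - (f s (t + k) - f s t)))).
    by rewrite -!vf.
  by rewrite e (mulrCA k^-1) (mulKf h0) (mulKf k0).
have qPsi s t (e : R) : 0 < e -> exists2 d : R, 0 < d & forall h k, h != 0 -> k != 0 ->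
    `|h| <= d -> `|k| <= d -> `|Re (L2inner (q s h) (q t k)) - Psi (s, t)| <= e.
  move=> e0; have /nbhs_ballP[d d0 hd] : \forall p \near (s, t), `|Psi (s, t) - Psi p| <= e.
    exact: (cvgrPdist_le _ _).1 (cPsi (s, t)) e e0.
  exists (d / 2); first by rewrite divr_gt0.
  move=> h k h0 k0 hh hk; have [a [b [ha hb ->]]] := qE s t h k h0 k0.
  have d2d : d / 2 < d by rewrite ltr_pdivrMr// ltr_pMr// ltr1n.
  rewrite distrC; apply: (hd (a, b)); split => /=.
    by rewrite /ball/= distrC; apply: le_lt_trans d2d; exact: le_trans hh.
  by rewrite /ball/= distrC; apply: le_lt_trans d2d; exact: le_trans hk.
have qq s (e : R) : 0 < e -> exists2 d : R, 0 < d & forall h k, h != 0 -> k != 0 ->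
    `|h| <= d -> `|k| <= d -> L2norm (q s h - q s k) <= e.
  move=> e0; have [|d d0 hd] := qPsi s s (e ^+ 2 / 4); first by rewrite divr_gt0// exprn_gt0.
  exists d => // h k h0 k0 hh hk.
  by apply: (@gram_close _ _ _ (Psi (s, s)) _ (ltW e0)); apply: hd.
have small (d : R) : 0 < d -> exists N, forall n, (N <= n)%N -> `|n.+1%:R^-1 : R| <= d.
  by move=> /harmonic_small[N hN]; exists N => n /hN; rewrite ger0_norm// invr_ge0.
have nz n : n.+1%:R^-1 != 0 :> R by rewrite invr_eq0 pnatr_eq0.
have /choice[v' hv'] : forall s, exists G : L2 R, forall e, 0 < e -> exists N,
    forall n, (N <= n)%N -> L2norm (q s n.+1%:R^-1 - G) <= e.
  move=> s; apply: L2_complete => e e0; have [d d0 hd] := qq s e e0.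
  by have [N hN] := small d d0; exists N => n m Nn Nm; apply: hd => //; exact: hN.
(* [v' s] is a limit along the increments 1/(n+1) only; the Cauchy estimate [qq] compares any other
   small [h] with these. *)
have dv s : derivable (v : R -> RL2 R) s 1 /\ derive1 (v : R -> RL2 R) s = v' s.
  apply/derive1P => e e0.
  have e20 : 0 < e / 2 by rewrite divr_gt0.
  have [d d0 hd] := qq s _ e20; have [N1 h1] := small d d0; have [N2 h2] := hv' s _ e20.
  exists d => // h h0 hhd.
  rewrite -[X in X <= _]/(L2norm (q s h - v' s)).
  set n := maxn N1 N2; rewrite -(subrK (q s n.+1%:R^-1) (q s h)) -addrA (splitr e).
  apply: le_trans (L2normD _ _) (lerD _ _); last exact: h2 (leq_maxr _ _).
  by apply: hd => //; exact: h1 (leq_maxl _ _).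
split=> s; first by case: (dv s).
move=> t; have [[_ ->] [_ ->]] := (dv s, dv t).
apply: (Re_L2inner_limit (hv' s) (hv' t)) => e e0.
have [d d0 hd] := qPsi s t e e0; have [N hN] := small d d0.
by exists N => n m Nn Nm; apply: hd => //; exact: hN.
Qed.

End GramDerivative.

Section FeatureSmooth.
Variable R : realType.

Lemma cRe_scale (a : R) (z : Rcomplex R) : Re (a *: z) = a * Re z.
Proof. by case: z. Qed.

Lemma derive1_Re (f : R -> Rcomplex R) s : derivable f s 1 ->
  derivable (fun t => Re (f t) : R^o) s 1 /\
  derive1 (fun t => Re (f t) : R^o) s = Re (derive1 f s).
Proof.
apply: (@derive1_bounded_linear R (Rcomplex R) R^o (fun z => Re z) 1) => [x y|a x|x].
- by rewrite cReD cReN.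
- exact: cRe_scale.
- by rewrite mul1r; exact: Re_le_normc.
Qed.

Lemma derivable_continuous (V : normedModType R) (f : R -> V) :
  (forall s, derivable f s 1) -> continuous f.
Proof.
by move=> df s; apply: differentiable_continuous; apply/derivable1_diffP.
Qed.

Lemma feature_smooth (v : R -> L2 R) (K : R -> R -> Rcomplex R) :
  smooth_kernel K -> (forall s t, Re (L2inner (v s) (v t)) = Re (K t s)) ->
  smooth_C0 (v : R -> RL2 R).
Proof.
move=> sK vK.
(* The Gram matrix of [v] at (s, t) is [K t s], with the variables exchanged: differentiating in s
   is [D2], then in t is [D1]. Each derivative of the curve therefore prepends [false :: true] to
   the word. *)
pose w i := iter i (fun w : seq bool => false :: true :: w) [::].
have step i : (forall s t,
      Re (L2inner (derive1n i (v : R -> RL2 R) s) (derive1n i (v : R -> RL2 R) t)) =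
      Re (partial (w i) K t s)) ->
    (forall s, derivable (derive1n i (v : R -> RL2 R)) s 1) /\
    (forall s t,
      Re (L2inner (derive1n i.+1 (v : R -> RL2 R) s) (derive1n i.+1 (v : R -> RL2 R) t)) =
      Re (partial (w i.+1) K t s)).
  move=> IH.
  have [_ dw _] := sK (w i).
  have [dw' _ _] := sK (true :: w i).
  have [_ _ [cw _]] := sK (w i.+1).
  have e1 b a : derivable (fun s => Re (partial (w i) K b s) : R^o) a 1 /\
      derive1 (fun s => Re (partial (w i) K b s) : R^o) a = Re (partial (true :: w i) K b a).
    exact: derive1_Re.
  have e2 b a : derivable (fun t => Re (partial (true :: w i) K t a) : R^o) b 1 /\
      derive1 (fun t => Re (partial (true :: w i) K t a) : R^o) b = Re (partial (w i.+1) K b a).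
    exact: (derive1_Re (dw' b a)).
  have e12 a : (fun b => derive1 (fun s => Re (partial (w i) K b s) : R^o) a) =
      (fun b => Re (partial (true :: w i) K b a)).
    by apply/funext => b; case: (e1 b a).
  have [|||dv gv] := @gram_derivable R _ (fun s t => Re (partial (w i) K t s)) IH.
  - by move=> a b; case: (e1 b a).
  - by move=> a b; rewrite e12; case: (e2 b a).
  - rewrite (_ : (fun p : R * R => _) = (fun p => Re (partial (w i.+1) K p.2 p.1))); last first.
      by apply/funext => p; rewrite e12; case: (e2 p.2 p.1).
    move=> p; have h : (q.2, q.1) @[q --> p] --> (p.2, p.1).
      apply: (@cvg_pair _ _ _ (nbhs p) (nbhs p.2) (nbhs p.1) _ _ _ snd fst).
        exact: cvg_snd.
      exact: cvg_fst.
    apply: (continuous_comp (f := fun q : R * R => partial (w i.+1) K q.2 q.1)).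
      exact: (continuous_comp h (cw (p.2, p.1))).
    exact: cRe_continuous.
  split=> // s t; rewrite (gv s t) e12.
  by case: (e2 t s).
have gram i : forall s t,
    Re (L2inner (derive1n i (v : R -> RL2 R) s) (derive1n i (v : R -> RL2 R) t)) =
    Re (partial (w i) K t s).
  by elim: i => // i /step[].
have dv i s : derivable (derive1n i (v : R -> RL2 R)) s 1 by case: (step i (gram i)).
split=> // i; split; first exact: derivable_continuous.
(* On the diagonal the Gram matrix is the squared norm, so a partial derivative of [K] below
   [e ^+ 2] off a compact [C] of the plane gives a norm below [e] off the projection of [C]. *)
move=> e e0; have [_ _ [_ /(_ (e ^+ 2)) [|C cC hC]]] := sK (w i); first by rewrite exprn_gt0.
exists (fst @` C).
  apply: continuous_compact cC; apply: continuous_subspaceT => p; exact: cvg_fst.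
move=> s hs; rewrite -[X in X < _]/(L2norm (derive1n i (v : R -> RL2 R) s)).
rewrite -ltr_sqr ?nnegrE ?L2norm_ge0 ?ltW// L2norm_sqr gram.
apply: le_lt_trans (ler_norm _) _; apply: le_lt_trans (Re_le_normc _) _.
by apply: (hC (s, s)) => hC'; apply: hs; exists (s, s).
Qed.

End FeatureSmooth.

(** * Continuous representatives *)

Section Evaluation.
Variable R : realType.
Local Notation mu := (@lebesgue_measure R).

(** If the functions differed at a point, they would differ on a ball around it, which has positive
    measure. *)
Lemma ae_eq_continuous (V : normedModType R) (f g : R -> V) :
  continuous f -> continuous g -> {ae mu, forall x, f x = g x} -> f = g.
Proof.
move=> cf cg [N [mN N0 sN]]; apply/funext => x; apply/eqP/negPn/negP => fg.
have e0 : 0 < `|f x - g x| / 2 by rewrite divr_gt0// normr_gt0 subr_eq0.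
have h1 : \forall y \near x, `|f x - f y| < `|f x - g x| / 2.
  exact: (cvgrPdist_lt _ _).1 (cf x) _ e0.
have h2 : \forall y \near x, `|g x - g y| < `|f x - g x| / 2.
  exact: (cvgrPdist_lt _ _).1 (cg x) _ e0.
have /nbhs_ballP[d d0 hd] : \forall y \near x, `|f x - f y| < `|f x - g x| / 2 /\
    `|g x - g y| < `|f x - g x| / 2 by exact: filterI h1 h2.
have dN : ball x d `<=` N.
  move=> y /hd[a b]; apply: sN => /= fgy.
  have := ltrD a b; rewrite -splitr distrC [`|g x - g y|]distrC fgy => c.
  have := ler_distD (g y) (f x) (g x); rewrite [`|f x - g y|]distrC.
  by move=> /le_lt_trans/(_ c); rewrite ltxx.
have : (mu (ball x d) <= mu N)%E.
  by apply: le_measure; rewrite ?inE//; exact: measurable_ball.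
move=> /le_trans; rewrite N0 => /(_ _ (lexx _)).
move=> h; have := lebesgue_measure_ball x (ltW d0) => e.
have : ((d *+ 2)%:E <= 0 :> \bar R)%E by rewrite -e.
by rewrite lee_fin leNgt pmulrn_lgt0 ?d0.
Qed.

Lemma crepE (F : L2 R) (h : R -> Rcomplex R) : C0 h -> in_class F h -> crep F = h.
Proof.
move=> hc hF; have [] : is_crep F (crep F) by apply: (@xgetPex _ _ [set h | is_crep F h]); exists h.
move=> cc cF; apply: ae_eq_continuous; [by case: cc|by case: hc|].
by apply: filterS2 cF hF => x <- <-.
Qed.

Lemma conjc_normr (z : Rcomplex R) : `|conjc z : Rcomplex R| = `|z|.
Proof. exact: normc_conj. Qed.

Lemma Rcomplex_scaleE (a : R) (z : Rcomplex R) : a *: z = a%:C%C * z :> R[i].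
Proof. by case: z => b c; apply: complex_eqP; rewrite /= mul0r ?subr0 ?addr0. Qed.

Section InnerLinear.
Variable F : L2 R.

Lemma inner_rB (x y : RL2 R) :
  L2inner F (x - y) = L2inner F x - L2inner F y :> Rcomplex R.
Proof. exact: L2innerBr. Qed.

Lemma inner_rZ (a : R) (x : RL2 R) :
  L2inner F (a *: x) = a *: (L2inner F x : Rcomplex R) :> Rcomplex R.
Proof. by rewrite Rcomplex_scaleE L2innerZr conjc_real. Qed.

Lemma inner_r_bound (x : RL2 R) : `|L2inner F x : Rcomplex R| <= L2norm F * `|x|.
Proof. exact: L2_cauchy_schwarz. Qed.

Lemma inner_lB (x y : RL2 R) :
  L2inner (x - y : L2 R) F = L2inner x F - L2inner y F :> Rcomplex R.
Proof. exact: L2innerBl. Qed.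

Lemma inner_lZ (a : R) (x : RL2 R) :
  L2inner (a *: x : RL2 R) F = a *: (L2inner x F : Rcomplex R) :> Rcomplex R.
Proof. by rewrite Rcomplex_scaleE L2innerZl. Qed.

Lemma inner_l_bound (x : RL2 R) : `|L2inner x F : Rcomplex R| <= L2norm F * `|x|.
Proof. by rewrite mulrC; exact: L2_cauchy_schwarz. Qed.

End InnerLinear.

Section OperatorLinear.
Variable A : L2 R -> L2 R.
Hypothesis hA : bounded_operator A.

Lemma op_realB (x y : RL2 R) : (A (x - y) : RL2 R) = A x - A y.
Proof. exact: bounded_opB. Qed.

Lemma op_realZ (a : R) (x : RL2 R) : (A (a *: x : RL2 R) : RL2 R) = a *: (A x : RL2 R).
Proof. exact: bounded_opZ. Qed.

End OperatorLinear.

Lemma smooth_C0_op A (a : R -> RL2 R) : bounded_operator A -> smooth_C0 a ->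
  smooth_C0 (fun s => A (a s) : RL2 R) /\
  forall i, derive1n i (fun s => A (a s) : RL2 R) = (fun s => A (derive1n i a s)).
Proof.
move=> hA sa; have [M M0 hM] := bounded_op_bound hA; split.
  exact: (smooth_C0_bounded_linear (op_realB hA) (op_realZ hA) hM).
by move=> i; apply: (derive1n_bounded_linear (op_realB hA) (op_realZ hA) hM); case: sa.
Qed.

(** The Riesz vectors of the point evaluations of [A], chosen so that they depend smoothly on the
    point. For each [F] the identity may fail on a null set of its own. *)
Definition evaluates (A : L2 R -> L2 R) (a : R -> RL2 R) : Prop :=
  smooth_C0 a /\ forall F, {ae mu, forall s, A F s = L2inner F (a s)}.

Lemma evaluates_comp A B a : evaluates A a -> bounded_operator B ->
  evaluates (A \o B) (fun s => adjoint B (a s)).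
Proof.
move=> [sa hA] hB; split; first by case: (smooth_C0_op (adjoint_bounded hB) sa).
by move=> F; apply: filterS (hA (B F)) => s /= ->; rewrite (adjointE hB).
Qed.

Lemma smooth_C0_inner (F : L2 R) (a : R -> RL2 R) : smooth_C0 a ->
  smooth_C0 (fun s => L2inner F (a s) : Rcomplex R) /\
  forall i, derive1n i (fun s => L2inner F (a s) : Rcomplex R) =
    (fun s => L2inner F (derive1n i a s)).
Proof.
move=> sa; split.
  exact: (smooth_C0_bounded_linear (inner_rB F) (inner_rZ F) (inner_r_bound F)).
by move=> i; apply: (derive1n_bounded_linear (inner_rB F) (inner_rZ F) (inner_r_bound F)); case: sa.
Qed.

Lemma smooth_C0_innerl (F : L2 R) (a : R -> RL2 R) : smooth_C0 a ->
  smooth_C0 (fun s => L2inner (a s) F : Rcomplex R) /\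
  forall i, derive1n i (fun s => L2inner (a s) F : Rcomplex R) =
    (fun s => L2inner (derive1n i a s) F).
Proof.
move=> sa; split.
  exact: (smooth_C0_bounded_linear (inner_lB F) (inner_lZ F) (inner_l_bound F)).
by move=> i; apply: (derive1n_bounded_linear (inner_lB F) (inner_lZ F) (inner_l_bound F)); case: sa.
Qed.

Lemma evaluates_crep A a F : evaluates A a ->
  crep (A F) = (fun s => L2inner F (a s)) /\ has_smooth_crep (A F).
Proof.
move=> [sa hA]; have [[df cf] _] := smooth_C0_inner F sa.
have e : crep (A F) = (fun s => L2inner F (a s)) by apply: crepE; [exact: (cf 0%N)|exact: hA].
split=> //; split; rewrite e//; split; [exact: (cf 0%N)|exact: hA].
Qed.

Lemma evaluates_crep_derive A a F i s : evaluates A a ->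
  derive1n i (crep (A F)) s = L2inner F (derive1n i a s).
Proof.
by move=> hA; have [-> _] := evaluates_crep F hA; case: hA => /(smooth_C0_inner F)[_ ->].
Qed.

Lemma evaluates_factor (V : L2 R -> L2 R) (K : R -> R -> Rcomplex R) :
  bounded_operator V -> Kinfty_kernel K -> integral_operator (V \o adjoint V) K ->
  exists v, evaluates V v.
Proof.
move=> hV [_ sK _ _] hK; have [_ _ [cK _]] := sK [::].
have [v [v1 v2]] := feature_map hV hK cK.
by exists v; split=> //; exact: feature_smooth sK v1.
Qed.

(** For fixed [F], both curves paired with [F] give [A F] almost everywhere. Both pairings are
    continuous in [s], so they agree at every [s]; only then may [F] vary, and the vectors
    coincide. *)
Lemma kernel_evaluates A a K : evaluates A a -> bounded_operator A ->
  Kinfty_kernel K -> integral_operator A K -> carleman_fun K = a.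
Proof.
move=> [[da ca] hA] bA [_ sK [sqK [dK cK]] _] [_ hK].
apply/funext => s; apply: L2inner_inj => F.
suff /(congr1 (@^~ s)) -> : (fun s => L2inner F (carleman_fun K s) : Rcomplex R) =
  (fun s => L2inner F (a s) : Rcomplex R) by [].
apply: ae_eq_continuous.
- by case: (smooth_C0_inner F (conj dK cK)) => -[_ /(_ 0%N)[]].
- by case: (smooth_C0_inner F (conj da ca)) => -[_ /(_ 0%N)[]].
apply: filterS2 (hA F) (hK F) => {}s <- [[ir ii] ->].
rewrite /L2inner; have sqc : square_integrable (fun t => conjc (K s t)).
  have [mK fK] := sqK s; split; first exact: cmeasurable_conj.
  rewrite (_ : (fun x => normc (K s x)^*%C) = (fun x => normc (K s x)))//.
  by apply/funext => x; rewrite normc_conj.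
apply: ae_eq_cintegral.
- exact: L2_cmeasurable_mul.
- apply: cmeasurableM; last exact: L2_cmeasurable.
  by case: (sqK s).
by apply: filterS (L2classP sqc) => t ->; rewrite conjcK mulrC.
Qed.

End Evaluation.

(** * Uniform convergence of expansions *)

Section UniformC0.
Variables (R : realType) (X : topologicalType) (B : normedModType R).

Lemma uniform_cvgP (F : nat -> X -> B) (g : X -> B) :
  (forall e, 0 < e -> exists N, forall n, (N <= n)%N -> forall x, `|g x - F n x| <= e) ->
  {uniform, F @ \oo --> g}.
Proof.
move=> h P /uniform_nbhs[E [entE EP]].
move: entE; rewrite -entourage_ballE => -[e /= e0 eE].
have [|N hN] := h (e / 2); first by rewrite divr_gt0.
exists N => // n /= Nn; apply: EP => y _; apply: eE => /=.
rewrite -ball_normE /ball_/=; apply: le_lt_trans (hN n Nn y) _.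
by rewrite ltr_pdivrMr// ltr_pMr// ltr1n.
Qed.

Lemma C0_uniform_limit (F : nat -> X -> B) (g : X -> B) :
  (forall n, C0 (F n)) ->
  (forall e, 0 < e -> exists N, forall n, (N <= n)%N -> forall x, `|g x - F n x| <= e) ->
  C0 g.
Proof.
move=> F0 h; split.
  move=> x; apply/cvgrPdist_le => e e0.
  have [|N hN] := h (e / 3); first by rewrite divr_gt0.
  have e30 : 0 < e / 3 by rewrite divr_gt0.
  have Fx : \forall y \near x, `|F N x - F N y| <= e / 3.
    exact: (cvgrPdist_le _ _).1 ((F0 N).1 x) _ e30.
  apply: filterS Fx => y hy.
  have h1 := hN N (leqnn _) x; have := hN N (leqnn _) y; rewrite distrC => h2.
  have := ler_distD (F N x) (g x) (g y); have := ler_distD (F N y) (F N x) (g y).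
  lra.
move=> e e0; have [|N hN] := h (e / 2); first by rewrite divr_gt0.
have [|K cK hK] := (F0 N).2 (e / 2); first by rewrite divr_gt0.
exists K => // x /hK h1; have h2 := hN N (leqnn _) x.
have := ler_normD (g x - F N x) (F N x); rewrite subrK.
lra.
Qed.

Lemma C0_zero : C0 (fun _ : X => 0 : B).
Proof.
split; first by move=> x; exact: cvg_cst.
by move=> e e0; exists set0; [exact: compact0|move=> x _; rewrite normr0].
Qed.

Lemma C0_add (f g : X -> B) : C0 f -> C0 g -> C0 (fun x => f x + g x).
Proof.
move=> [cf f0] [cg g0]; split; first by move=> x; apply: cvgD; [exact: cf|exact: cg].
move=> e e0; have e2 : 0 < e / 2 by rewrite divr_gt0.
have [K cK hK] := f0 _ e2; have [L cL hL] := g0 _ e2.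
exists (K `|` L); first exact: compactU.
move=> x /not_orP[/hK h1 /hL h2]; apply: le_lt_trans (ler_normD _ _) _.
by rewrite (splitr e) ltrD.
Qed.

Lemma C0_series (f : nat -> X -> B) n : (forall k, C0 (f k)) ->
  C0 (fun x => series (f ^~ x) n).
Proof.
move=> hf; elim: n => [|n IH].
  rewrite (_ : (fun x => _) = (fun=> 0)); first exact: C0_zero.
  by apply/funext => x; rewrite /series/= big_geq.
rewrite (_ : (fun x => _) = (fun x => series (f ^~ x) n + f n x)); first exact: C0_add.
by apply/funext => x; rewrite /series/= big_nat_recr.
Qed.

Lemma C0_norm (f : X -> B) : C0 f -> C0 (fun x => `|f x| : R^o).
Proof.
move=> [cf f0]; split; first by move=> x; apply: cvg_norm; exact: cf.
by move=> e e0; have [K cK hK] := f0 e e0; exists K => // x /hK; rewrite normr_id.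
Qed.

Lemma C0_bounded (f : X -> B) : C0 f -> exists2 M, 0 <= M & forall x, `|f x| <= M.
Proof.
move=> [cf f0]; have [K cK hK] := f0 1 ltr01.
have : compact (f @` K) by apply: continuous_compact => //; exact: continuous_subspaceT.
move=> /compact_bounded[A [_ hA]].
exists (`|A| + 1); first by rewrite addr_ge0.
move=> x; have [xK|xK] := pselect (K x).
  by apply: (hA (`|A| + 1)); [rewrite ltr_pwDr// ler_norm|exists x].
by apply: ltW; apply: lt_le_trans (hK x xK) _; rewrite lerDr.
Qed.

Lemma series_cvg_C0P (f : nat -> X -> B) (g : X -> B) :
  (forall n, C0 (f n)) ->
  (forall e, 0 < e -> exists N, forall n, (N <= n)%N -> forall x,
    `|g x - series (f ^~ x) n| <= e) ->
  series_cvg_C0 f g.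
Proof.
move=> hf h; split=> //; last exact: uniform_cvgP.
by apply: C0_uniform_limit h => n; exact: C0_series.
Qed.

End UniformC0.

(** The sum is defined pointwise by monotone convergence; letting the upper index of a uniformly
    small tail grow shows that the convergence is uniform. *)
Lemma series_abscvg_C0P (R : realType) (X : topologicalType) (B : normedModType R)
    (f : nat -> X -> B) :
  (forall n, C0 (f n)) ->
  (forall e, 0 < e -> exists M, forall N, (M <= N)%N -> forall x,
    \sum_(M <= n < N) `|f n x| <= e) ->
  series_abscvg_C0 f.
Proof.
move=> hf h; split=> //.
pose S x : nat -> R^o := series (fun n => `|f n x| : R^o).
have Sle x m n : (m <= n)%N -> S x m <= S x n.
  by move=> mn; rewrite /S /series/= (big_cat_nat (leq0n m) mn)/= lerDl sumr_ge0.
have cS x : cvgn (S x).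
  apply: nondecreasing_is_cvgn; first exact: Sle.
  have [M hM] := h 1 ltr01; exists (S x M + 1) => _ [n _ <-].
  have [nM|Mn] := leqP n M.
    by apply: le_trans (Sle x _ _ nM) _; rewrite lerDl.
  rewrite /S /series/= (big_cat_nat (leq0n M) (ltnW Mn))/= lerD2l.
  exact: hM (ltnW Mn) x.
exists (fun x => limn (S x)); apply: series_cvg_C0P.
  by move=> n; exact: C0_norm.
move=> e e0; have [M hM] := h e e0; exists M => n Mn x.
have lS : S x n <= limn (S x).
  by apply: limr_ge => //; exists n => // m /= nm; exact: Sle.
rewrite ger0_norm ?subr_ge0// lerBlDl.
apply: limr_le => //; exists n => // m /= nm.
rewrite -/(S x n) /S /series/= (big_cat_nat (leq0n n) nm)/= lerD2l.
apply: le_trans (hM m (leq_trans Mn nm) x).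
by rewrite [leRHS](big_cat_nat Mn nm)/= lerDr sumr_ge0.
Qed.

Section ComplexProducts.
Variable R : realType.

(** Functions in C0 are bounded. Outside a product of two compact sets one factor is small while the
    other stays bounded. *)
Lemma C0_mul_conj (f g : R -> Rcomplex R) : C0 f -> C0 g ->
  C0 (fun p : R * R => (f p.1 : Rcomplex R) * conjc (g p.2) : Rcomplex R).
Proof.
move=> hf hg; have [A A0 hA] := C0_bounded hf; have [C C0' hC] := C0_bounded hg.
have [cf f0] := hf; have [cg g0] := hg.
have nM (z w : Rcomplex R) : `|z * conjc w : Rcomplex R| = `|z| * `|w|.
  by rewrite [LHS]normcM -[normc w^*%C]/(`|conjc w : Rcomplex R|) conjc_normr.
have A1 : 0 < A + 1 by rewrite ltr_wpDl.
have C1 : 0 < C + 1 by rewrite ltr_wpDl.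
split.
  move=> [s t]; apply/cvgrPdist_le => e e0.
  have ea : 0 < e / 2 / (C + 1) by rewrite !divr_gt0.
  have eb : 0 < e / 2 / (A + 1) by rewrite !divr_gt0.
  have h1 : \forall p \near (s, t), `|f s - f p.1| <= e / 2 / (C + 1).
    have c1 : fst @ (s, t) --> s by exact: cvg_fst.
    exact: c1 _ ((cvgrPdist_le _ _).1 (cf s) _ ea).
  have h2 : \forall p \near (s, t), `|g t - g p.2| <= e / 2 / (A + 1).
    have c2 : snd @ (s, t) --> t by exact: cvg_snd.
    exact: c2 _ ((cvgrPdist_le _ _).1 (cg t) _ eb).
  apply: filterS2 h1 h2 => -[s' t'] /= h1 h2.
  have -> : (f s * conjc (g t) - f s' * conjc (g t') : Rcomplex R) =
      (f s - f s') * conjc (g t) + f s' * conjc (g t - g t') :> Rcomplex R.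
    by rewrite rmorphB /= mulrBl mulrBr addrA subrK.
  apply: le_trans (ler_normD _ _) _; rewrite !nM.
  move: h1 h2; rewrite !ler_pdivlMr// => h1 h2.
  have := hA s'; have := hC t; have := normr_ge0 (f s - f s').
  have := normr_ge0 (g t - g t'); have := normr_ge0 (f s'); have := normr_ge0 (g t).
  nra.
move=> e e0.
have [|K cK hK] := f0 (e / (C + 1)); first by rewrite divr_gt0.
have [|L cL hL] := g0 (e / (A + 1)); first by rewrite divr_gt0.
exists (K `*` L); first exact: compact_setX.
move=> [s t] /not_andP[/= /hK|/= /hL]; rewrite nM ltr_pdivlMr// => h.
  by have := hC t; have := normr_ge0 (f s); nra.
by have := hA s; have := normr_ge0 (g t); nra.
Qed.

End ComplexProducts.

(** * Remainders of orthonormal expansions *)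

Section OrthonormalExpansion.
Variables (R : realType) (u : nat -> L2 R).
Hypothesis hu : orthonormal_basis u.

Definition partial_expansion n (F : L2 R) : L2 R :=
  \sum_(0 <= k < n) L2inner F (u k) *: u k.

Local Notation rem n F := (F - partial_expansion n F).

(** Pythagoras: the terms already removed are orthogonal to [u n], so the remainder keeps the
    coefficient of [F] at [u n]. *)
Lemma rem_sqrS n F :
  L2norm (rem n.+1 F) ^+ 2 = L2norm (rem n F) ^+ 2 - normc (L2inner F (u n)) ^+ 2.
Proof.
have o1 : L2inner (rem n F) (u n) = L2inner F (u n).
  rewrite L2innerBl L2inner_suml big1_seq ?subr0// => k /andP[_].
  rewrite mem_index_iota => /andP[_ kn]; rewrite L2innerZl (proj1 hu).
  by rewrite ltn_eqF// mulr0.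
have o2 : L2norm (u n) ^+ 2 = 1 by rewrite L2norm_sqr (proj1 hu) eqxx.
rewrite /partial_expansion big_nat_recr//= opprD addrA -/(partial_expansion n F).
rewrite [in LHS]L2norm_sqrB L2innerZr o1 L2normZ exprMn o2 mulr1 normc_sqr.
rewrite cReM cReconj cImconj; ring.
Qed.

Lemma rem0 F : rem 0%N F = F.
Proof. by rewrite /partial_expansion big_geq// subr0. Qed.

Lemma rem_sqr M N F : (M <= N)%N ->
  \sum_(M <= k < N) normc (L2inner F (u k)) ^+ 2 =
  L2norm (rem M F) ^+ 2 - L2norm (rem N F) ^+ 2.
Proof.
move=> MN; rewrite -[RHS]opprB -(telescope_sumr (fun k => L2norm (rem k F) ^+ 2) MN).
rewrite -sumrN; apply: eq_bigr => k _.
by rewrite rem_sqrS; ring.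
Qed.

Lemma bessel_tail M N F : (M <= N)%N ->
  \sum_(M <= k < N) normc (L2inner F (u k)) ^+ 2 <= L2norm (rem M F) ^+ 2.
Proof. by move=> MN; rewrite rem_sqr// gerBl sqr_ge0. Qed.

Lemma rem_le n F : L2norm (rem n F) <= L2norm F.
Proof.
rewrite -ler_sqr ?nnegrE ?L2norm_ge0// -subr_ge0.
have := @rem_sqr 0%N n F (leq0n n); rewrite rem0 => <-.
by apply: sumr_ge0 => k _; exact: sqr_ge0.
Qed.

Lemma remB n F G : rem n (F - G) = rem n F - rem n G.
Proof.
have -> : partial_expansion n (F - G) = partial_expansion n F - partial_expansion n G.
  by rewrite /partial_expansion -sumrB; apply: eq_bigr => k _; rewrite L2innerBl scalerBl.
by rewrite !opprB addrACA [RHS]addrACA [- G - _]addrC.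
Qed.

Lemma rem_cvg F e : 0 < e -> exists N, forall n, (N <= n)%N -> L2norm (rem n F) <= e.
Proof.
move=> e0; have [_ /(_ F)] := hu => /cvgrPdist_le/(_ e e0)[N _ hN].
by exists N => n /hN.
Qed.

(** Taking remainders is linear and does not increase norms, so convergence at one point spreads to
    a neighborhood with the same [n], then to a compact set. Outside that set the vectors, hence
    their remainders, are small already. *)
Lemma rem_cvg_C0 (X : topologicalType) (x : X -> RL2 R) : C0 x ->
  forall e, 0 < e -> exists N, forall n, (N <= n)%N -> forall p, L2norm (rem n (x p)) <= e.
Proof.
move=> [cx x0] e e0; have e2 : 0 < e / 2 by rewrite divr_gt0.
have [K /compact_near_coveringP cK hK] := x0 e e0.
have /cK : forall p, K p -> \forall q \near p & n \near \oo, L2norm (rem n (x q)) <= e.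
  move=> p _; have [N hN] := rem_cvg (x p) e2.
  have hq : \forall q \near p, L2norm (x p - x q : L2 R) <= e / 2.
    exact: (cvgrPdist_le _ _).1 (cx p) _ e2.
  exists ([set q | L2norm (x p - x q : L2 R) <= e / 2], [set n | (N <= n)%N]).
    by split=> //; exists N.
  move=> [q n] [/= h1 h2].
  rewrite -(subKr (x p) (x q)) remB (splitr e); apply: le_trans (L2normD _ _) _.
  by rewrite L2normN; apply: lerD; [exact: hN|exact: le_trans (rem_le _ _) h1].
move=> [N _ hN]; exists N => n Nn p.
have [pK|pK] := pselect (K p); first exact: hN n Nn p pK.
by apply: le_trans (rem_le _ _) (ltW (hK p pK)).
Qed.

(** By 2 a b <= a^2 + b^2 the tail is at most the mean of two tails of squares, controlled by the
    remainders. Uniform smallness of remainders is assumed instead of C0 so that one of the two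
    families may be constant, as in (3). *)
Lemma expansion_product_tail (X : Type) (x y : X -> L2 R) :
  (forall e, 0 < e -> exists N, forall n, (N <= n)%N -> forall p, L2norm (rem n (x p)) <= e) ->
  (forall e, 0 < e -> exists N, forall n, (N <= n)%N -> forall p, L2norm (rem n (y p)) <= e) ->
  forall e, 0 < e -> exists M, forall N, (M <= N)%N -> forall p,
    \sum_(M <= n < N) normc (L2inner (x p) (u n)) * normc (L2inner (y p) (u n)) <= e.
Proof.
(* Capping [d] at 1 gives [d ^+ 2 <= e]. *)
move=> hx hy e e0; pose d := Num.min 1 e.
have d0 : 0 < d by rewrite lt_min ltr01.
have d1 : d ^+ 2 <= e.
  have : d <= 1 by rewrite ge_min lexx.
  have : d <= e by rewrite ge_min lexx orbT.
  by move: d0; nra.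
have [M1 h1] := hx d d0; have [M2 h2] := hy d d0.
pose M := maxn M1 M2; exists M => N MN p.
have b1 := le_trans (bessel_tail (x p) MN) _.
have b2 := le_trans (bessel_tail (y p) MN) _.
have {}b1 : \sum_(M <= k < N) normc (L2inner (x p) (u k)) ^+ 2 <= d ^+ 2.
  by apply: b1; rewrite ler_sqr ?nnegrE ?L2norm_ge0 ?(ltW d0)// h1// leq_maxl.
have {}b2 : \sum_(M <= k < N) normc (L2inner (y p) (u k)) ^+ 2 <= d ^+ 2.
  by apply: b2; rewrite ler_sqr ?nnegrE ?L2norm_ge0 ?(ltW d0)// h2// leq_maxr.
apply: (@le_trans _ _ (2^-1 * (\sum_(M <= k < N) normc (L2inner (x p) (u k)) ^+ 2 +
    \sum_(M <= k < N) normc (L2inner (y p) (u k)) ^+ 2))).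
  rewrite -big_split mulr_sumr; apply: ler_sum => k _.
  move: (normc (L2inner (x p) (u k))) (normc (L2inner (y p) (u k))) => a b.
  by have := sqr_ge0 (a - b); rewrite /=; nra.
by move: b1 b2 d1; lra.
Qed.

End OrthonormalExpansion.

Section ExpansionSeries.
Variables (R : realType) (u : nat -> L2 R).
Hypothesis hu : orthonormal_basis u.

(** Parseval: [b] is expanded in the basis inside the continuous functional [x -> L2inner x a]. *)
Lemma expansion_pairing_cvg (b a : L2 R) :
  series (fun n => (L2inner (u n) a : Rcomplex R) * conjc (L2inner (u n) b)) @ \oo -->
  (L2inner b a : Rcomplex R).
Proof.
apply/cvgrPdist_le => e e0.
have c0 : 0 < L2norm a + 1 by rewrite ltr_wpDl// L2norm_ge0.
have [|N hN] := rem_cvg hu b (e := e / (L2norm a + 1)); first by rewrite divr_gt0.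
exists N => // n /= Nn.
have -> : series (fun n => (L2inner (u n) a : Rcomplex R) * conjc (L2inner (u n) b)) n =
    L2inner (partial_expansion u n b) a.
  rewrite L2inner_suml; apply: eq_bigr => k _.
  by rewrite L2innerZl -L2innerC mulrC.
rewrite -[X in X <= _]/(normc (L2inner b a - L2inner (partial_expansion u n b) a)).
rewrite -L2innerBl; apply: le_trans (L2_cauchy_schwarz _ _) _.
have := hN n Nn; rewrite ler_pdivlMr//; apply: le_trans.
by apply: ler_wpM2l; rewrite ?L2norm_ge0// lerDl.
Qed.

(** The partial sums are [A] applied to those of the expansion of [a s], since <a s, u n> is the
    conjugate of <u n, a s>. Both series of (2) have this shape. *)
Lemma expansion_op_cvg (A : L2 R -> L2 R) (a : R -> RL2 R) :
  bounded_operator A -> C0 a ->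
  series_cvg_C0 (fun n s => (conjc (L2inner (u n) (a s)) *: A (u n) : RL2 R))
    (fun s => A (a s) : RL2 R).
Proof.
move=> hA ca; have [M M0 hM] := bounded_op_bound hA.
apply: series_cvg_C0P.
  move=> n.
  apply: (@C0_bounded_linear R (RL2 R) (RL2 R)
    (fun x : RL2 R => (conjc (L2inner (u n) x) *: A (u n) : RL2 R))
    (L2norm (u n) * L2norm (A (u n)))) => //.
  - by move=> x y; rewrite L2innerBr rmorphB scalerBl.
  - move=> x; rewrite -[X in X <= _]/(L2norm (conjc (L2inner (u n) x) *: A (u n))).
    rewrite L2normZ normc_conj mulrAC; apply: ler_wpM2r; first exact: L2norm_ge0.
    exact: L2_cauchy_schwarz.
move=> e e0; have M1 : 0 < M + 1 by rewrite ltr_wpDl.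
have [|N hN] := rem_cvg_C0 hu ca (e := e / (M + 1)); first by rewrite divr_gt0.
exists N => n Nn s.
have -> : series (fun n => (conjc (L2inner (u n) (a s)) *: A (u n) : RL2 R)) n =
    A (partial_expansion u n (a s)).
  rewrite /series/= /partial_expansion (bounded_op_sum _ _ _ hA).
  by apply: eq_bigr => k _; rewrite (bounded_opZ hA) (L2innerC (u k) (a s)).
rewrite -[X in X <= _]/(L2norm (A (a s) - A (partial_expansion u n (a s)))).
rewrite -(bounded_opB hA); apply: le_trans (hM _) _.
have := hN n Nn s; rewrite ler_pdivlMr//.
by have := L2norm_ge0 (a s - partial_expansion u n (a s) : L2 R); nra.
Qed.

Lemma expansion_abscvg (X : topologicalType) (f : nat -> X -> Rcomplex R)
    (a b : X -> L2 R) :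
  (forall n, C0 (f n)) ->
  (forall n p, normc (f n p) = normc (L2inner (a p) (u n)) * normc (L2inner (b p) (u n))) ->
  (forall e, 0 < e -> exists N, forall n, (N <= n)%N -> forall p,
    L2norm (a p - partial_expansion u n (a p)) <= e) ->
  (forall e, 0 < e -> exists N, forall n, (N <= n)%N -> forall p,
    L2norm (b p - partial_expansion u n (b p)) <= e) ->
  series_abscvg_C0 f.
Proof.
move=> cf fE ha hb; apply: series_abscvg_C0P => // e e0.
have [M hM] := expansion_product_tail hu ha hb e0; exists M => N MN p.
apply: le_trans (hM N MN p); apply: ler_sum => n _.
by rewrite -fE.
Qed.

End ExpansionSeries.

(** * The kernel of the Fredholm resolvent and the formulae *)

Section ResolventKernel.
Variable R : realType.
Local Notation mu := (@lebesgue_measure R).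

Lemma adjointK (A : L2 R -> L2 R) : bounded_operator A -> adjoint (adjoint A) = A.
Proof.
move=> hA; symmetry; apply: adjoint_unique; first exact: adjoint_bounded.
by split=> // F G; rewrite (adjointEr hA).
Qed.

Lemma iter_D1 i (K : R -> R -> Rcomplex R) s t :
  iter i (@D1 R) K s t = derive1n i (K ^~ t) s.
Proof.
elim: i s => // i IH s; rewrite iterS /D1 derive1nS; congr (derive1 _ s).
by apply/funext => x; exact: IH.
Qed.

Lemma iter_D2 i (K : R -> R -> Rcomplex R) s t :
  iter i (@D2 R) K s t = derive1n i (K s) t.
Proof.
elim: i t => // i IH t; rewrite iterS /D2 derive1nS; congr (derive1 _ t).
by apply/funext => x; exact: IH.
Qed.

Lemma iter_partial_inner (a b : R -> RL2 R) i j s t : smooth_C0 a -> smooth_C0 b ->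
  iter j (@D2 R) (iter i (@D1 R) (fun s t => L2inner (b t) (a s) : Rcomplex R)) s t =
  L2inner (derive1n j b t) (derive1n i a s).
Proof.
move=> sa sb; rewrite iter_D2.
rewrite (_ : iter i (@D1 R) _ s = (fun t => L2inner (b t) (derive1n i a s))).
  by have [_ ->] := smooth_C0_innerl (derive1n i a s) sb.
by apply/funext => y; rewrite iter_D1; have [_ ->] := smooth_C0_inner (b y) sa.
Qed.

Lemma square_integrable_conj (f : R -> R[i]) :
  square_integrable f -> square_integrable (fun x => conjc (f x)).
Proof.
move=> [mf ff]; split; first exact: cmeasurable_conj.
rewrite (_ : (fun x => normc (f x)^*%C) = (fun x => normc (f x)))//.
by apply/funext => x; rewrite normc_conj.
Qed.

(** The equation of the resolvent at [W F], with [T] factored, exhibits [W] as the outermost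
    factor. *)
Lemma resolvent_factor (T W V : L2 R -> L2 R) l F : regular_values T l ->
  bounded_operator W -> T = W \o adjoint V ->
  resolvent T l (W F) = W (F + l *: adjoint V (resolvent T l (W F))).
Proof.
move=> hl hW TWV; have [_ h1 _] := resolventP hl.
have := h1 (W F); move: (resolvent T l (W F)) => G /eqP; rewrite subr_eq => /eqP e.
by rewrite {1}e TWV (bounded_opD hW) (bounded_opZ hW).
Qed.

(** The product is evaluated by [s -> B (a s)], which is therefore the Carleman function of [K].
    Reading [B (a s)] at t through [b] gives [K] for almost every t, and for all t by continuity;
    the same formula, read in s through [a], yields the other Carleman function. *)
Lemma product_kernel (A B : L2 R -> L2 R) (a b : R -> RL2 R) (K : R -> R -> Rcomplex R) :
  bounded_operator A -> bounded_operator B -> evaluates A a -> evaluates B b ->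
  Kinfty_kernel K -> integral_operator (A \o adjoint B) K ->
  [/\ carleman_fun K = (fun s => B (a s)),
      K = (fun s t => L2inner (b t) (a s)) &
      carleman_fun' K = (fun t => A (b t))].
Proof.
move=> hA hB ea eb kK iK; have hBa := adjoint_bounded hB.
have cK : carleman_fun K = (fun s => B (a s)).
  rewrite (kernel_evaluates (evaluates_comp ea hBa) _ kK iK) ?adjointK//.
  exact: bounded_op_comp.
have [_ sK [sqK _] [sqK' _]] := kK.
have [_ _ [cK0 _]] := sK [::].
have K_E : K = (fun s t => L2inner (b t) (a s)).
  apply/funext => s; apply: ae_eq_continuous.
  - exact: continuous_sectionl cK0.
  - by have [[_ /(_ 0%N)[]]] := smooth_C0_innerl (a s) eb.1.
  have := L2classP (square_integrable_conj (sqK s)).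
  rewrite -[L2class _]/(carleman_fun K s) cK => h.
  by apply: filterS2 h (eb.2 (a s)) => t -> /(congr1 (@conjc R)); rewrite conjcK -L2innerC.
split=> //; apply/funext => t; apply: L2ext.
apply: filterS2 (L2classP (square_integrable_conj (sqK' t))) (ea.2 (b t)) => s -> ->.
by rewrite /conj_transpose conjcK K_E.
Qed.

End ResolventKernel.
Theorem theorem8 (R : realType) (T : L2 R -> L2 R) (T0 : R -> R -> Rcomplex R)
    (hT : bounded_operator T) (hT0 : mercer_kernel T T0)
    (lambda : R[i]) (hlambda : regular_values T lambda) :
  (exists Tl : R -> R -> Rcomplex R,
     mercer_kernel (fredholm_resolvent T lambda) Tl) /\
  (forall Tl : R -> R -> Rcomplex R,
   mercer_kernel (fredholm_resolvent T lambda) Tl ->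
   forall W V : L2 R -> L2 R, M_factorization T W V ->
   forall u : nat -> L2 R, orthonormal_basis u ->
   let w n := resolvent T lambda (W (u n)) in
   let v n := V (u n) in
   (forall n, has_smooth_crep (w n) /\ has_smooth_crep (v n)) /\
   (forall F : L2 R, has_smooth_crep (fredholm_resolvent T lambda F)) /\
   forall i j : nat,
   [/\ series_abscvg_C0 (fun n (p : R * R) =>
         (derive1n i (crep (w n)) p.1 : Rcomplex R) *
         conjc (derive1n j (crep (v n)) p.2)) /\
       (forall s t : R,
         series (fun n => (derive1n i (crep (w n)) s : Rcomplex R) *
                          conjc (derive1n j (crep (v n)) t)) @ \oo -->
         iter j (@D2 R) (iter i (@D1 R) Tl) s t),
       series_cvg_C0 (fun n (s : R) =>
         (conjc (derive1n i (crep (w n)) s) *: v n : RL2 R))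
         (derive1n i (carleman_fun Tl)),
       series_cvg_C0 (fun n (t : R) =>
         (conjc (derive1n j (crep (v n)) t) *: w n : RL2 R))
         (derive1n j (carleman_fun' Tl)) &
       forall F : L2 R,
         series_abscvg_C0 (fun n (s : R) =>
           (L2inner F (v n) : Rcomplex R) * derive1n i (crep (w n)) s) /\
         forall s : R,
           series (fun n =>
             (L2inner F (v n) : Rcomplex R) * derive1n i (crep (w n)) s) @ \oo -->
           derive1n i (crep (fredholm_resolvent T lambda F)) s]).
Proof.
split; first exact: fredholm_mercer hT hT0 hlambda.
(* [Tl] is any Mercer kernel of the resolvent, not only the one found for (a); [product_kernel] will
   determine it. *)
move=> Tl [kTl iTl _] W V [hV hW TWV [mV _] [mW _]] u hu w v.
have [_ _ hM] := hT0.
have [KV kV iV] := hM _ mV; have [KW kW iW] := hM _ mW.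
have [b eb] := evaluates_factor hV kV iV.
have [a0 ea0] := evaluates_factor hW kW iW.
have hV' := adjoint_bounded hV.
have hR := resolvent_bounded hlambda.
set S := resolvent T lambda in w hR *.
pose Z F := F + lambda *: adjoint V (S (W F)).
have hZ : bounded_operator Z.
  apply: (@bounded_op_axpy _ _ idfun (adjoint V \o (S \o W))); first exact: bounded_op_id.
  by apply: bounded_op_comp => //; exact: bounded_op_comp.
have SW F : S (W F) = (W \o Z) F by exact: resolvent_factor.
pose a : R -> RL2 R := fun s => adjoint Z (a0 s).
have ea : evaluates (W \o Z) a := evaluates_comp ea0 hZ.
have hA : bounded_operator (W \o Z) by exact: bounded_op_comp.
(* With the resolvent written to the left of [T], the factor [W] of [T] meets it and the two merge
   into [W \o Z]. *)
have TlE : fredholm_resolvent T lambda = (W \o Z) \o adjoint V.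
  rewrite /fredholm_resolvent (resolvent_comm hT hlambda); apply/funext => F.
  by rewrite /= -/S [in LHS]TWV SW.
have eT := evaluates_comp ea hV'; rewrite (adjointK hV) -TlE in eT.
rewrite TlE in iTl.
have [cTl TlK cTl'] := product_kernel hA hV ea eb kTl iTl.
have [sa sb] := (ea.1, eb.1).
have wE n i : derive1n i (crep (w n)) = (fun s => L2inner (u n) (derive1n i a s)).
  by apply/funext => s; rewrite /w SW (evaluates_crep_derive _ _ _ ea).
have vE n i : derive1n i (crep (v n)) = (fun s => L2inner (u n) (derive1n i b s)).
  by apply/funext => s; rewrite /v (evaluates_crep_derive _ _ _ eb).
split.
  move=> n; rewrite /w SW; have [_ ?] := evaluates_crep (u n) ea.
  by have [_ ?] := evaluates_crep (u n) eb.
split; first by move=> F; case: (evaluates_crep F eT).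
move=> i j.
have ca : C0 (derive1n i a) by case: sa => _; exact.
have cb : C0 (derive1n j b) by case: sb => _; exact.
have cwi n : C0 (fun s => L2inner (u n) (derive1n i a s) : Rcomplex R).
  by have [[_ /(_ i) ci] hi] := smooth_C0_inner (u n) sa; move: ci; rewrite hi.
have cvj n : C0 (fun s => L2inner (u n) (derive1n j b s) : Rcomplex R).
  by have [[_ /(_ j) cj] hj] := smooth_C0_inner (u n) sb; move: cj; rewrite hj.
split.
- split.
    apply: (expansion_abscvg hu (a := fun p => derive1n i a p.1) (b := fun p => derive1n j b p.2)).
    + by move=> n; rewrite wE vE; exact: C0_mul_conj (cwi n) (cvj n).
    + move=> n p; rewrite wE vE normcM normc_conj.
      by rewrite (L2innerC (u n)) normc_conj (L2innerC (u n)) normc_conj.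
    + move=> e e0; have [N hN] := rem_cvg_C0 hu ca e0.
      by exists N => n Nn p; exact: hN.
    + move=> e e0; have [N hN] := rem_cvg_C0 hu cb e0.
      by exists N => n Nn p; exact: hN.
  move=> s t; rewrite TlK iter_partial_inner//.
  by under eq_fun do rewrite wE vE; exact: expansion_pairing_cvg.
- rewrite cTl; have [_ ->] := smooth_C0_op hV sa.
  rewrite (_ : (fun n s => _) = (fun n s =>
    (conjc (L2inner (u n) (derive1n i a s)) *: V (u n) : RL2 R))).
    exact: expansion_op_cvg.
  by apply/funext => n; rewrite wE.
- rewrite cTl'; have [_ ->] := smooth_C0_op hA sb.
  rewrite (_ : (fun n t => _) = (fun n t =>
    (conjc (L2inner (u n) (derive1n j b t)) *: (W \o Z) (u n) : RL2 R))).
    exact: expansion_op_cvg.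
  by apply/funext => n; rewrite vE /w SW.
(* The coefficients in (3) are those of the single vector [adjoint V F], so the series pairs this
   vector with the curve [a]. *)
move=> F; have FvE n : L2inner F (v n) = conjc (L2inner (u n) (adjoint V F)).
  by rewrite (adjointEr hV) -L2innerC.
split.
  (* The second family is constant in [s]: it does not vanish at infinity, but its remainders are
     trivially uniformly small. *)
  apply: (expansion_abscvg hu (a := fun s => derive1n i a s) (b := fun _ => adjoint V F)).
  + move=> n; rewrite wE.
    rewrite (_ : (fun s => _) =
      (fun s => L2inner (L2inner F (v n) *: u n) (derive1n i a s) : Rcomplex R)).
      have [[_ /(_ i) ci] hi] := smooth_C0_inner (L2inner F (v n) *: u n) sa.
      by move: ci; rewrite hi.
    by apply/funext => s; rewrite L2innerZl.
  + move=> n s; rewrite wE FvE normcM normc_conj mulrC.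
    by rewrite -(normc_conj (L2inner (u n) _)) -L2innerC -(normc_conj (L2inner (u n) _)) -L2innerC.
  + by move=> e e0; have [N hN] := rem_cvg_C0 hu ca e0; exists N.
  + by move=> e e0; have [N hN] := rem_cvg hu (adjoint V F) e0; exists N => n Nn _; exact: hN.
(* The derivative is <F, V a^(i)(s)>; with [V] moved to the other side it is the sum of the Parseval
   series of [adjoint V F] and a^(i)(s). *)
move=> s; rewrite (evaluates_crep_derive _ _ _ eT).
have [_ ->] := smooth_C0_op hV sa.
rewrite (adjointEr hV); under eq_fun do rewrite wE FvE mulrC.
exact: expansion_pairing_cvg.
Qed.
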